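(* Let $\mu$ be a non-atomic measure and let $\varphi$ be a finite Orlicz function. Then the Orlicz space $L_\varphi$ has the Daugavet property if and only if $\varphi$ is a linear function, i.e. there is $k>0$ such that $\varphi(u)=ku$ for all $u\ge0$; that is, $L_\varphi=L_1$ isometrically (up to a constant multiple of the norm).
   Context: All spaces are real; $(\Omega,\Sigma,\mu)$ is a complete $\sigma$-finite measure space with $\mu(\Omega)>0$. A Banach space $X$ has the Daugavet property if every rank one bounded linear operator $T:X\to X$ satisfies $\|I+T\|=1+\|T\|$. An Orlicz function is a convex, left-continuous function $\varphi:[0,\infty)\to[0,\infty]$ with $\varphi(0)=0$, not identically zero and not identically infinite on $(0,\infty)$; it is finite if it does not take the value $\infty$. For measurable $f:\Omega\to\mathbb{R}$ (modulo a.e. equality) let $I_\varphi(f)=\int_\Omega\varphi(|f|)\,d\mu$. $L_\varphi$ is the space of $f$ with $I_\varphi(\lambda f)<\infty$ for some $\lambda>0$, with the Luxemburg norm $\|f\|_\varphi=\inf\{\epsilon>0:I_\varphi(f/\epsilon)\le1\}$. $L_1=L_1(\Omega,\Sigma,\mu)$. *)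

(* Defs.v *)
From HB Require Import structures.
From mathcomp Require Import all_boot all_order all_algebra generic_quotient ring_quotient.
From mathcomp Require Import all_classical all_reals all_analysis.
From mathcomp Require Import measurable_realfun.
From mathcomp Require Import ring lra.

Set Implicit Arguments.
Unset Strict Implicit.
Unset Printing Implicit Defensive.

Import Order.TTheory GRing.Theory Num.Theory.
Import numFieldNormedType.Exports.

Local Open Scope classical_set_scope.
Local Open Scope ring_scope.

Definition opnorm (R : realType) (X : normedModType R) (A : X -> X) : R :=
  sup [set `|A x| | x in [set x : X | `|x| <= 1]].

Definition rank_one (R : realType) (X : normedModType R) (A : X -> X) : Prop :=
  exists2 y : X, y != 0 & range A = [set a *: y | a in [set: R]].

(* `bounded_near A (nbhs 0)` is boundedness of the linear operator A
   (see linear_boundedP, linear_bounded_continuous). *)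
Definition daugavet_property (R : realType) (X : normedModType R) : Prop :=
  forall A : {linear X -> X},
    bounded_near A (nbhs (0 : X)) -> rank_one A ->
    opnorm (fun x => x + A x) = 1 + opnorm A.

(* A function [0, +oo) -> [0, +oo] is encoded as a function on all of R whose
   values at negative arguments are unconstrained and never used. *)
Record orliczFunction (R : realType) := OrliczFunction {
  orlicz_fun :> R -> \bar R;
  orlicz_ge0 : forall u : R, 0 <= u -> (0 <= orlicz_fun u)%E;
  orlicz0 : orlicz_fun 0 = 0%E;
  orlicz_convex : forall t u v : R, 0 <= t <= 1 -> 0 <= u -> 0 <= v ->
    (orlicz_fun (t * u + (1 - t) * v)%R
       <= t%:E * orlicz_fun u + (1 - t)%:E * orlicz_fun v)%E;
  orlicz_left_continuous : forall u : R, 0 < u ->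
    orlicz_fun x @[x --> u^'-] --> orlicz_fun u;
  orlicz_neq0 : exists2 u : R, 0 < u & orlicz_fun u != 0%E;
  orlicz_neqy : exists2 u : R, 0 < u & orlicz_fun u != +oo%E
}.

Definition finite_orlicz (R : realType) (phi : orliczFunction R) : Prop :=
  forall u : R, 0 <= u -> phi u != +oo%E.

Definition nonatomic d (T : measurableType d) (R : realType)
    (mu : {measure set T -> \bar R}) : Prop :=
  forall A, measurable A -> (0 < mu A)%E ->
    exists B, [/\ measurable B, B `<=` A & (0 < mu B < mu A)%E].

Section modular.
Context d (T : measurableType d) (R : realType).
Variables (mu : {measure set T -> \bar R}) (phi : orliczFunction R).

Definition orlicz_modular (f : T -> R) : \bar R :=
  (\int[mu]_x phi `|f x|%R)%E.

Definition luxemburg_norm (f : T -> R) : R :=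
  inf [set e : R | 0 < e /\ (orlicz_modular (fun x => f x / e)%R <= 1)%E].

Definition finite_modular (f : T -> R) : Prop :=
  exists2 l : R, 0 < l & (orlicz_modular (fun x => l * f x)%R < +oo)%E.

Definition Lorlicz : {pred (T -> R)} :=
  [predI @mfun _ _ T R & mem [set f | finite_modular f]].
Definition Lorlicz_key : pred_key Lorlicz. Proof. exact. Qed.
Canonical Lorlicz_keyed := KeyedPred Lorlicz_key.

End modular.

Section modular_theory.
Context d (T : measurableType d) (R : realType).
Variables (mu : {measure set T -> \bar R}) (phi : orliczFunction R).
Local Notation I := (orlicz_modular mu phi).
Local Notation nm := (luxemburg_norm mu phi).
Implicit Types (f g : T -> R).

Lemma orlicz_contract (t u : R) : 0 <= t <= 1 -> 0 <= u ->
  (phi (t * u)%R <= t%:E * phi u)%E.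
Proof.
move=> t01 u0; have := @orlicz_convex _ phi t u 0 t01 u0 (lexx _).
by rewrite mulr0 addr0 orlicz0 mule0 adde0.
Qed.

Lemma orlicz_le (u v : R) : 0 <= u -> u <= v -> (phi u <= phi v)%E.
Proof.
move=> u0 uv; have v0 := le_trans u0 uv.
have [vz|vn0] := eqVneq v 0.
  by have -> : u = v by apply/eqP; rewrite eq_le uv vz u0.
have vp : 0 < v by rewrite lt_def vn0.
have t01 : 0 <= u / v <= 1 by rewrite divr_ge0// ler_pdivrMr// mul1r.
have := orlicz_contract t01 v0; rewrite divfK// => /le_trans; apply.
rewrite -[leRHS]mul1e; apply: lee_wpmul2r; first exact: orlicz_ge0.
by rewrite lee_fin; case/andP: t01.
Qed.

Lemma measurable_orlicz_norm : measurable_fun [set: R] (fun u : R => phi `|u|).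
Proof.
apply: (measurability _ (ErealGenOInfty.measurableE R)).
move=> /= _ [_ [a ->] <-]; rewrite setTI.
rewrite -[X in measurable X]setCK; apply: measurableC.
apply: is_interval_measurable => x y /=.
rewrite !in_itv/= !andbT => /negP; rewrite -leNgt => xa /negP.
rewrite -leNgt => ya z /andP[xz zy] /=; rewrite in_itv/= andbT; apply/negP.
rewrite -leNgt; have [xz'|xz'] := leP `|z| `|x|.
  exact: le_trans (orlicz_le (normr_ge0 _) xz') xa.
suff zy' : `|z| <= `|y| by exact: le_trans (orlicz_le (normr_ge0 _) zy') ya.
have [z0|z0] := leP 0 z.
  by rewrite (ger0_norm z0) (le_trans zy)// ler_norm.
move: xz'; rewrite (ltr0_norm z0) (ler0_norm (le_trans xz (ltW z0))).
by rewrite ltrN2 ltNge xz.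
Qed.

Lemma measurable_modular f : measurable_fun setT f ->
  measurable_fun setT (fun x => phi `|f x|).
Proof. by move=> mf; exact: (measurableT_comp measurable_orlicz_norm mf). Qed.

Lemma modular_ge0 f : (0 <= I f)%E.
Proof. by apply: integral_ge0 => x _; exact: orlicz_ge0. Qed.

Lemma modular_eq0 : I (cst 0) = 0%E.
Proof.
rewrite /orlicz_modular; under eq_integral do rewrite /= normr0 orlicz0.
by rewrite integral0.
Qed.

Lemma le_modular f g : measurable_fun setT f -> measurable_fun setT g ->
  (forall x, `|f x| <= `|g x|) -> (I f <= I g)%E.
Proof.
move=> mf mg fg; apply: ge0_le_integral => //.
- by move=> x _; exact: orlicz_ge0.
- exact: measurable_modular.
- exact: measurable_modular.
- by move=> x _; exact: orlicz_le (normr_ge0 _) (fg x).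
Qed.

Lemma eq_modular f g : (forall x, `|f x| = `|g x|) -> I f = I g.
Proof. by move=> fg; apply: eq_integral => x _; rewrite fg. Qed.

Lemma ae_eq_modular f g : measurable_fun setT f -> measurable_fun setT g ->
  {ae mu, forall x, f x = g x} -> I f = I g.
Proof.
move=> mf mg fg; apply: ge0_ae_eq_integral => //.
- exact: measurable_modular.
- exact: measurable_modular.
- by move=> x _; exact: orlicz_ge0.
- by move=> x _; exact: orlicz_ge0.
- by apply: filterS fg => x -> _.
Qed.

Lemma modular_comb (a b : R) f g (h : T -> R) : 0 <= a -> 0 < b ->
  measurable_fun setT f -> measurable_fun setT g -> measurable_fun setT h ->
  (forall x, `|h x| <= a * `|f x| + b * `|g x|) ->
  (I (fun x => h x / (a + b))%R <=
     (a / (a + b))%:E * I f + (b / (a + b))%:E * I g)%E.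
Proof.
move=> a0 b0 mf mg mh hfg.
have ab0 : 0 < a + b by rewrite ltr_wpDl.
set t := a / (a + b).
have t01 : 0 <= t <= 1.
  by rewrite divr_ge0 ?(ltW ab0)//= ler_pdivrMr// mul1r lerDl ltW.
have -> : b / (a + b) = 1 - t.
  by rewrite /t; field; rewrite gt_eqF.
have t0 : 0 <= t by case/andP: t01.
have t1 : 0 <= 1 - t by rewrite subr_ge0; case/andP: t01.
have mF := measurable_modular mf; have mG := measurable_modular mg.
rewrite -ge0_integralZl//; last by move=> x _; exact: orlicz_ge0.
rewrite -ge0_integralZl//; last by move=> x _; exact: orlicz_ge0.
rewrite -ge0_integralD//; last 4 first.
- by move=> x _; rewrite mule_ge0// ?lee_fin// orlicz_ge0.
- exact: measurable_funeM.
- by move=> x _; rewrite mule_ge0// ?lee_fin// orlicz_ge0.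
- exact: measurable_funeM.
apply: ge0_le_integral => //.
- by move=> x _; exact: orlicz_ge0.
- apply: measurable_modular; exact: measurable_funM.
- by apply: emeasurable_funD; exact: measurable_funeM.
move=> x _; apply: le_trans (orlicz_convex phi t01 (normr_ge0 _) (normr_ge0 _)).
apply: orlicz_le => //.
have -> : 1 - t = b / (a + b).
  by rewrite /t; field; rewrite gt_eqF.
rewrite normrM normfV (gtr0_norm ab0) /t.
have -> : a / (a + b) * `|f x| + b / (a + b) * `|g x| =
          (a * `|f x| + b * `|g x|) / (a + b) by ring.
by rewrite ler_pM2r ?invr_gt0.
Qed.

Lemma modular_contract (t : R) f : measurable_fun setT f -> 0 <= t <= 1 ->
  (I (fun x => (t * f x)%R) <= t%:E * I f)%E.
Proof.
move=> mf t01; have t0 : 0 <= t by case/andP: t01.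
rewrite -ge0_integralZl//; last 2 first.
- exact: measurable_modular.
- by move=> x _; exact: orlicz_ge0.
apply: ge0_le_integral => //.
- by move=> x _; exact: orlicz_ge0.
- by apply: measurable_modular; exact: measurable_funM.
- by apply: measurable_funeM; exact: measurable_modular.
by move=> x _; rewrite normrM (ger0_norm t0); exact: orlicz_contract.
Qed.

Lemma finite_modular_comb (a : R) f g : measurable_fun setT f ->
  measurable_fun setT g -> finite_modular mu phi f -> finite_modular mu phi g ->
  finite_modular mu phi (fun x => a * f x + g x).
Proof.
move=> mf mg [l l0 lf] [k k0 kg].
have c0 : 0 < `|a| / l + k^-1.
  by rewrite ltr_wpDl ?invr_gt0// divr_ge0// ltW.
exists (`|a| / l + k^-1)^-1; first by rewrite invr_gt0.
have := @modular_comb (`|a| / l) k^-1 (fun x => l * f x) (fun x => k * g x)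
  (fun x => a * f x + g x).
rewrite (_ : (fun x => (a * f x + g x) / _) =
             (fun x => (`|a| / l + k^-1)^-1 * (a * f x + g x))); last first.
  by apply/funext => x; rewrite mulrC.
move=> /(_ _ _ _ _ _ _)/le_lt_trans; apply.
- by rewrite divr_ge0// ltW.
- by rewrite invr_gt0.
- exact: measurable_funM.
- exact: measurable_funM.
- by apply: measurable_funD => //; exact: measurable_funM.
- move=> x; apply: le_trans (ler_normD _ _) _.
  rewrite !normrM (gtr0_norm l0) (gtr0_norm k0) mulrA divfK ?gt_eqF//.
  by rewrite mulKf ?gt_eqF.
- have l1 := ltW l0; have k1 := ltW k0.
  by rewrite lte_add_pinfty// lte_mul_pinfty// lee_fin !divr_ge0// ?addr_ge0// ?divr_ge0// ?invr_ge0.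
Qed.

Lemma Lorlicz_submod_closed : submod_closed (Lorlicz mu phi).
Proof.
split.
  apply/andP; split; first by rewrite inE /=; exact: (measurable_cst (0 : R)).
  rewrite inE /=; exists 1 => //.
  rewrite (eq_modular (g := cst 0)) ?modular_eq0// => x /=.
  by rewrite mulr0.
move=> a f g /andP[/[!inE]/= mf lf] /andP[/[!inE]/= mg lg].
apply/andP; split; rewrite inE/=.
  by apply: measurable_funD => //; exact: measurable_funM.
exact: finite_modular_comb.
Qed.

HB.instance Definition _ := GRing.isSubmodClosed.Build _ _ (Lorlicz mu phi)
  Lorlicz_submod_closed.

Let S f := [set e : R | 0 < e /\ (I (fun x => f x / e)%R <= 1)%E].

Lemma luxemburg_lbound f : lbound (S f) 0.
Proof. by move=> e [/ltW]. Qed.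

Lemma luxemburg_neq0 f : measurable_fun setT f -> finite_modular mu phi f ->
  S f !=set0.
Proof.
move=> mf [l l0 lf].
have M0 : 0 <= fine (I (fun x => l * f x)) by rewrite fine_ge0// modular_ge0.
have ME : I (fun x => l * f x) = (fine (I (fun x => l * f x)))%:E.
  by rewrite fineK// ge0_fin_numE// modular_ge0.
set M := fine _ in M0 ME.
have M1 : 0 < M + 1 by rewrite ltr_wpDl.
exists ((M + 1) / l); split; first by rewrite divr_gt0.
rewrite (_ : (fun x => f x / ((M + 1) / l)) =
             (fun x => (M + 1)^-1 * (l * f x))); last first.
  by apply/funext => x; rewrite invf_div; ring.
apply: le_trans (modular_contract _ _) _.
- exact: measurable_funM.
- by rewrite invr_ge0 (ltW M1) invf_le1// lerDr.
by rewrite ME lee_fin mulrC ler_pdivrMr// mul1r lerDl.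
Qed.

Lemma luxemburg_le f e : S f e -> nm f <= e.
Proof. by move=> Sfe; apply: ge_inf => //; exists 0; exact: luxemburg_lbound. Qed.

Lemma luxemburg_ge f (m : R) : measurable_fun setT f ->
  finite_modular mu phi f -> (forall e, S f e -> m <= e) -> m <= nm f.
Proof. by move=> mf lf h; apply: lb_le_inf => //; exact: luxemburg_neq0. Qed.

Lemma luxemburg_ge0 f : measurable_fun setT f -> finite_modular mu phi f ->
  0 <= nm f.
Proof. by move=> mf lf; apply: luxemburg_ge => // e; exact: luxemburg_lbound. Qed.

Lemma luxemburg_gt f e : measurable_fun setT f -> finite_modular mu phi f ->
  nm f < e -> S f e.
Proof.
move=> mf lf nfe.
have [e' [e'0 Ie'] e'e] : exists2 e', S f e' & e' < e.
  apply: contrapT => h; move: nfe; rewrite ltNge => /negP; apply.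
  apply: luxemburg_ge => // e' Se'; rewrite leNgt; apply/negP => e'e.
  by apply: h; exists e'.
have e0 := lt_trans e'0 e'e; split => //.
apply: le_trans Ie'; apply: le_modular.
- exact: measurable_funM.
- exact: measurable_funM.
move=> x; rewrite !normrM !normfV (gtr0_norm e0) (gtr0_norm e'0).
by rewrite ler_wpM2l// lef_pV2// ltW.
Qed.

Lemma luxemburgD f g : measurable_fun setT f -> measurable_fun setT g ->
  finite_modular mu phi f -> finite_modular mu phi g ->
  nm (f \+ g) <= nm f + nm g.
Proof.
move=> mf mg lf lg.
rewrite -lerBlDr; apply: luxemburg_ge => // a [a0 Ia].
rewrite lerBlDr addrC -lerBlDr; apply: luxemburg_ge => // b [b0 Ib].
rewrite lerBlDr addrC; apply: luxemburg_le; split; first exact: addr_gt0.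
have := @modular_comb a b (fun x => f x / a) (fun x => g x / b) (f \+ g).
move=> /(_ (ltW a0) b0 _ _ _ _)/le_trans; apply.
- exact: measurable_funM.
- exact: measurable_funM.
- exact: measurable_funD.
- move=> x; rewrite !normrM !normfV (gtr0_norm a0) (gtr0_norm b0).
  by rewrite ![_ * (_ / _)]mulrC !divfK ?gt_eqF//; exact: ler_normD.
have ab0 : 0 < a + b by exact: addr_gt0.
have abE : (1 = (a / (a + b))%:E * 1 + (b / (a + b))%:E * 1 :> \bar R)%E.
  by rewrite !mule1 -EFinD -mulrDl divff// gt_eqF.
by rewrite [leRHS]abE leeD// lee_wpmul2l// lee_fin divr_ge0// ltW.
Qed.

Lemma luxemburgZ_le (a : R) f : a != 0 -> measurable_fun setT f ->
  finite_modular mu phi f -> nm (fun x => a * f x) <= `|a| * nm f.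
Proof.
move=> a0 mf lf; have a1 : 0 < `|a| by rewrite normr_gt0.
rewrite -ler_pdivrMl//; apply: luxemburg_ge => // e [e0 Ie].
rewrite ler_pdivrMl//; apply: luxemburg_le; split; first exact: mulr_gt0.
rewrite (eq_modular (g := fun x => f x / e))// => x.
rewrite !normrM !normfV !normrM normr_id invfM.
by rewrite mulrACA divff ?mul1r ?gt_eqF.
Qed.

Lemma luxemburg0 : nm (cst 0) = 0.
Proof.
have mf : measurable_fun setT (cst 0 : T -> R) by exact: measurable_cst.
have I0 (e : R) : I (fun x => (cst 0 x / e)%R) = 0%E.
  by rewrite -modular_eq0; apply: eq_modular => x /=; rewrite mul0r.
have lf : finite_modular mu phi (cst 0 : T -> R).
  exists 1 => //; rewrite (eq_modular (g := cst 0)) ?modular_eq0//.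
  by move=> x /=; rewrite mulr0.
apply/eqP; rewrite eq_le luxemburg_ge0// andbT.
apply/ler_addgt0Pl => e e0; rewrite addr0.
by apply: luxemburg_le; split => //; rewrite I0.
Qed.

Lemma finite_modularZ (a : R) f : measurable_fun setT f ->
  finite_modular mu phi f -> finite_modular mu phi (fun x => a * f x).
Proof.
move=> mf lf; have := @finite_modular_comb a f (cst 0) mf (measurable_cst _) lf.
rewrite (_ : (fun x => a * f x + cst 0 x) = (fun x => a * f x)); last first.
  by apply/funext => x /=; rewrite addr0.
apply; exists 1 => //; rewrite (eq_modular (g := cst 0)) ?modular_eq0//.
by move=> x /=; rewrite mulr0.
Qed.

Lemma luxemburgZ (a : R) f : measurable_fun setT f ->
  finite_modular mu phi f -> nm (fun x => a * f x) = `|a| * nm f.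
Proof.
move=> mf lf; have [->|a0] := eqVneq a 0.
  rewrite normr0 mul0r -[RHS]luxemburg0; congr nm.
  by apply/funext => x /=; rewrite mul0r.
apply/eqP; rewrite eq_le luxemburgZ_le//=.
have := @luxemburgZ_le a^-1 (fun x => a * f x).
rewrite invr_eq0 a0 => /(_ isT (measurable_funM (measurable_cst _) mf)).
move=> /(_ (finite_modularZ _ mf lf)).
rewrite (_ : (fun x => a^-1 * (a * f x)) = f); last first.
  by apply/funext => x /=; rewrite mulrA mulVf// mul1r.
by rewrite normfV ler_pdivlMl// normr_gt0.
Qed.

Lemma ae_eq_luxemburg f g : measurable_fun setT f -> measurable_fun setT g ->
  {ae mu, forall x, f x = g x} -> nm f = nm g.
Proof.
move=> mf mg fg; rewrite /luxemburg_norm; congr inf; apply/seteqP.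
by split => e [e0 Ie]; split => //; move: Ie; rewrite (@ae_eq_modular
  (fun x => f x / e) (fun x => g x / e))//;
  first [exact: measurable_funM | apply: filterS fg => x ->].
Qed.

Lemma luxemburg_eq0 f : measurable_fun setT f -> finite_modular mu phi f ->
  nm f = 0 -> {ae mu, forall x, f x = 0}.
Proof.
move=> mf lf nf0.
have If (s : R) : 0 < s -> I (fun x => (s * f x)%R) = 0%E.
  move=> s0; apply/eqP; rewrite eq_le modular_ge0 andbT.
  apply/lee_addgt0Pr => e e0; rewrite add0e.
  have [|d0 Id] := @luxemburg_gt f (s^-1 * Num.min e 1) mf lf.
    by rewrite nf0 mulr_gt0 ?invr_gt0// lt_min e0 ltr01.
  have m0 : 0 < Num.min e 1 by rewrite lt_min e0 ltr01.
  set m := Num.min e 1 in d0 Id m0.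
  have m01 : 0 <= m <= 1 by rewrite (ltW m0) ge_min lexx orbT.
  rewrite (_ : (fun x => s * f x) = (fun x => m * (f x / (s^-1 * m)))).
    apply: le_trans (modular_contract _ m01) _; first exact: measurable_funM.
    apply: le_trans (_ : (m%:E * 1 <= _)%E); last first.
      by rewrite mule1 lee_fin ge_min lexx.
    by apply: lee_wpmul2l => //; rewrite lee_fin ltW.
  by apply/funext => x; field; rewrite !gt_eqF.
have [u0 u00 phiu0] := orlicz_neq0 phi.
have aeF : {ae mu, forall x (n : nat), phi `|n.+1%:R * f x|%R = 0%E}.
  apply: ae_foralln => n.
  have mF : measurable_fun setT (fun x => phi `|n.+1%:R * f x|%R).
    by apply: measurable_modular; exact: measurable_funM.
  have := (ae_eq_integral_abs mu measurableT mF).1.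
  have -> : (\int[mu]_x `|phi `|n.+1%:R * f x|%R| = 0)%E.
    under eq_integral do rewrite gee0_abs ?orlicz_ge0//.
    exact: If.
  by move=> /(_ erefl); apply: filterS => x /(_ Logic.I).
apply: filterS aeF => x Fx; apply: contrapT => /eqP fx0.
have fx : 0 < `|f x| by rewrite normr_gt0.
pose n := Num.truncn (u0 / `|f x|).
have un : u0 <= `|n.+1%:R * f x|.
  by rewrite normrM normr_nat -ler_pdivrMr// ltW// /n truncnS_gt.
have := orlicz_le (ltW u00) un; rewrite Fx => pu.
by move: phiu0; rewrite eq_le pu orlicz_ge0// ltW.
Qed.

End modular_theory.

Section orlicz_space.
Context d (T : measurableType d) (R : realType).
Variables (mu : {measure set T -> \bar R}) (phi : orliczFunction R).

Definition LorliczFun := {f : T -> R | f \in Lorlicz mu phi}.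
HB.instance Definition _ := Choice.on LorliczFun.
HB.instance Definition _ := SubType.on LorliczFun.
HB.instance Definition _ := [SubChoice_isSubLmodule of LorliczFun by <:].

Definition ae_null : {pred LorliczFun} :=
  mem [set f : LorliczFun | {ae mu, forall x, val f x = 0}].

Lemma ae_nullP (f : LorliczFun) :
  (f \in ae_null) <-> {ae mu, forall x, val f x = 0}.
Proof. by rewrite inE. Qed.

Lemma ae_null_zmod_closed : zmod_closed ae_null.
Proof.
split=> [|f g /ae_nullP f0 /ae_nullP g0]; apply/ae_nullP; first exact: nearW.
by apply: filterS2 f0 g0 => x /= fx gx; rewrite !fctE/= fx gx subrr.
Qed.

HB.instance Definition _ := GRing.isZmodClosed.Build LorliczFun ae_null
  ae_null_zmod_closed.

(* L_phi proper: classes of functions modulo a.e. equality. *)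
Definition OrliczSpace : Type := Quotient.quot ae_null.
HB.instance Definition _ := GRing.Zmodule.on OrliczSpace.
HB.instance Definition _ := EqQuotient.on OrliczSpace.


Local Open Scope quotient_scope.

Implicit Types (a b : R) (p q : OrliczSpace) (f g : LorliczFun).

Lemma OrliczSpace_eqP f g :
  \pi_OrliczSpace f = \pi_OrliczSpace g <->
  {ae mu, forall x, val f x = val g x}.
Proof.
have E : (f - g \in ae_null) = (f == g %[mod OrliczSpace]) :=
  @Quotient.idealrBE _ ae_null f g.
split=> [/eqP|fg]; last (apply/eqP; move: fg).
  rewrite -E => /ae_nullP; apply: filterS => x /=.
  by rewrite !fctE => /eqP; rewrite subr_eq0 => /eqP.
rewrite -E => fg; apply/ae_nullP; apply: filterS fg => x /= fgx.
by rewrite !fctE/= fgx subrr.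
Qed.

Definition OrliczSpace_scale a p : OrliczSpace := \pi_OrliczSpace (a *: repr p).

Lemma OrliczSpace_piZ a f :
  OrliczSpace_scale a (\pi_OrliczSpace f) = \pi_OrliczSpace (a *: f).
Proof.
apply/OrliczSpace_eqP.
have : \pi_OrliczSpace (repr (\pi_OrliczSpace f)) = \pi_OrliczSpace f.
  by rewrite reprK.
move=> /OrliczSpace_eqP; apply: filterS => x fx.
by rewrite !linearZ/= !fctE fx.
Qed.

Lemma OrliczSpace_piD f g :
  \pi_OrliczSpace f + \pi_OrliczSpace g = \pi_OrliczSpace (f + g).
Proof. exact: esym (@Quotient.pi_add _ ae_null f g). Qed.

Lemma OrliczSpace_pi0 : \pi_OrliczSpace 0 = 0.
Proof. by apply: (addrI (\pi_OrliczSpace 0)); rewrite OrliczSpace_piD !addr0. Qed.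

Lemma OrliczSpace_surj p : exists f, p = \pi_OrliczSpace f.
Proof. by exists (repr p); rewrite reprK. Qed.

Lemma OrliczSpace_scalerA a b p :
  OrliczSpace_scale a (OrliczSpace_scale b p) = OrliczSpace_scale (a * b) p.
Proof.
have [f ->] := OrliczSpace_surj p.
by rewrite (OrliczSpace_piZ b) (OrliczSpace_piZ a) OrliczSpace_piZ scalerA.
Qed.

Lemma OrliczSpace_scale1r : left_id 1 OrliczSpace_scale.
Proof.
by move=> p; have [f ->] := OrliczSpace_surj p; rewrite OrliczSpace_piZ scale1r.
Qed.

Lemma OrliczSpace_scalerDr : right_distributive OrliczSpace_scale +%R.
Proof.
move=> a p q; have [f ->] := OrliczSpace_surj p.
have [g ->] := OrliczSpace_surj q.
rewrite OrliczSpace_piD (OrliczSpace_piZ a f) (OrliczSpace_piZ a g).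
by rewrite OrliczSpace_piZ OrliczSpace_piD scalerDr.
Qed.

Lemma OrliczSpace_scalerDl p :
  {morph OrliczSpace_scale^~ p : a b / a + b}.
Proof.
move=> a b /=; have [f ->] := OrliczSpace_surj p.
by rewrite (OrliczSpace_piZ a) (OrliczSpace_piZ b) OrliczSpace_piZ
  OrliczSpace_piD scalerDl.
Qed.

HB.instance Definition _ := GRing.Zmodule_isLmodule.Build R OrliczSpace
  OrliczSpace_scalerA OrliczSpace_scale1r OrliczSpace_scalerDr
  OrliczSpace_scalerDl.

Definition OrliczSpace_norm p : R := luxemburg_norm mu phi (val (repr p)).

Lemma LorliczFunP f :
  measurable_fun setT (val f) /\ finite_modular mu phi (val f).
Proof. by case: f => f /= /andP[/[!inE]]. Qed.

Lemma OrliczSpace_norm_pi f :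
  OrliczSpace_norm (\pi_OrliczSpace f) = luxemburg_norm mu phi (val f).
Proof.
apply: ae_eq_luxemburg; [exact: (LorliczFunP _).1|exact: (LorliczFunP _).1|].
by apply/OrliczSpace_eqP; rewrite reprK.
Qed.

Lemma OrliczSpace_ler_normD p q :
  OrliczSpace_norm (p + q) <= OrliczSpace_norm p + OrliczSpace_norm q.
Proof.
have [f ->] := OrliczSpace_surj p; have [g ->] := OrliczSpace_surj q.
rewrite OrliczSpace_piD !OrliczSpace_norm_pi.
have [mf lf] := LorliczFunP f; have [mg lg] := LorliczFunP g.
exact: luxemburgD.
Qed.

Lemma OrliczSpace_normrZ a p :
  OrliczSpace_norm (a *: p) = `|a| * OrliczSpace_norm p.
Proof.
have [f ->] := OrliczSpace_surj p; have [mf lf] := LorliczFunP f.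
rewrite [_ *: _]OrliczSpace_piZ !OrliczSpace_norm_pi.
exact: luxemburgZ.
Qed.

Lemma OrliczSpace_normr0_eq0 p : OrliczSpace_norm p = 0 -> p = 0.
Proof.
have [f ->] := OrliczSpace_surj p; have [mf lf] := LorliczFunP f.
rewrite OrliczSpace_norm_pi => /(luxemburg_eq0 mf lf) f0.
by rewrite -OrliczSpace_pi0; apply/OrliczSpace_eqP.
Qed.

HB.instance Definition _ := Lmodule_isNormed.Build R OrliczSpace
  OrliczSpace_ler_normD OrliczSpace_normrZ OrliczSpace_normr0_eq0.

End orlicz_space.

(* L_phi = L_1 as sets of functions, with Luxemburg norm k times the L_1 norm. *)
Definition orlicz_isometric_L1 d (T : measurableType d) (R : realType)
    (mu : {measure set T -> \bar R}) (phi : orliczFunction R) (k : R) : Prop :=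
  (forall f : T -> R, (f \in Lorlicz mu phi) <-> (f \in Lfun mu 1)) /\
  (forall f : T -> R, f \in Lorlicz mu phi ->
    ((luxemburg_norm mu phi f)%:E = k%:E * 'N[mu]_1[EFin \o f])%E).

(* Main.v *)
(** A linear [phi] makes [L_phi] isometric to [L_1] up to the factor [k]; an
    isometric copy of [L_1] over a non-atomic measure has the Daugavet property;
    and the Daugavet property forces [phi] to be linear.

    For [L_1]: let [A] be of rank one with range spanned by [y], and let [h]
    nearly attain its norm.  Since the [L_1] norm is additive over disjoint
    pieces, some restriction [g] of [h] to a set carrying little of [|y|] still
    nearly attains the norm of [A], and [g] and [A g] are then almost disjointly
    supported, so [|g + A g|] is nearly [|g| + |A g|].

    For the converse: if [phi] is not linear, then for large [c] every supporting
    line of [phi] at [c] has slope [s > phi c / c].  Choose a small set [B] with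
    [phi c * mu B = 1] and let [E] be the conditional expectation on [B].  Then
    [-E] has rank one and norm one, but [|h - E h| <= 2 - delta] on the unit ball:
    if the mean of [h] on [B] is nearly maximal (close to [c]), the gap
    [s * c - phi c > 0] forces [h >= eta] on most of [B], where
    [|h - E h| <= |h| + |E h| - 2 * eta]. *)

Require Import Defs.
From HB Require Import structures.
From mathcomp Require Import all_boot all_order all_algebra.
From mathcomp Require Import all_classical all_reals all_analysis.
From mathcomp Require Import measurable_realfun ring lra.

Set Implicit Arguments.
Unset Strict Implicit.
Unset Printing Implicit Defensive.

Import Order.TTheory GRing.Theory Num.Theory.
Import numFieldNormedType.Exports.

Local Open Scope classical_set_scope.
Local Open Scope ring_scope.

(** * Non-atomic measures *)

Section nonatomic_measure.
Context d (T : measurableType d) (R : realType).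
Variable nu : {measure set T -> \bar R}.
Hypothesis nu_nonatomic : nonatomic nu.

(** Non-atomicity splits [A] into two pieces of positive measure, and the smaller one has at most
    half the measure. *)
Lemma nonatomic_half (A : set T) : measurable A -> (0 < nu A)%E ->
  (nu A < +oo)%E ->
  exists B, [/\ measurable B, B `<=` A, (0 < nu B)%E & (nu B + nu B <= nu A)%E].
Proof.
move=> mA A0 Afin; have [B [mB BA /andP[B0 BltA]]] := nu_nonatomic mA A0.
have AE : (nu A = nu B + nu (A `\` B))%E.
  rewrite -measureU//; last 2 first.
  - exact: measurableD.
  - by rewrite setDE setICA setICr setI0.
  by rewrite setDUK.
have Bfin : nu B \is a fin_num.
  by rewrite ge0_fin_numE// (le_lt_trans _ Afin)// le_measure// inE.
have [le|lt] := leP (nu B) (nu (A `\` B)).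
  by exists B; split => //; rewrite AE leeD2lE.
exists (A `\` B); split.
- exact: measurableD.
- exact: subDsetl.
- rewrite lt0e measure_ge0 andbT; apply/eqP => D0.
  by move: BltA; rewrite AE D0 adde0 ltxx.
- by rewrite AE leeD// ltW.
Qed.

(** Repeated halving: after [n] steps the measure is at most [nu A / 2 ^+ n], and [n < 2 ^+ n] makes
    this as small as required. *)
Lemma nonatomic_small (A : set T) (e : R) : measurable A -> (0 < nu A)%E ->
  (nu A < +oo)%E -> 0 < e ->
  exists B, [/\ measurable B, B `<=` A & (0 < nu B <= e%:E)%E].
Proof.
move=> mA A0 Afin e0.
have H n : exists B, [/\ measurable B, B `<=` A, (0 < nu B)%E &
    fine (nu B) * 2 ^+ n <= fine (nu A)].
  elim: n => [|n [B [mB BA B0 Bn]]].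
    by exists A; split => //; rewrite expr0 mulr1.
  have Bfin : (nu B < +oo)%E.
    by rewrite (le_lt_trans _ Afin)// le_measure// inE.
  have [C [mC CB C0 CC]] := nonatomic_half mB B0 Bfin.
  exists C; split => //; first exact: subset_trans BA.
  have Cfin : nu C \is a fin_num.
    by rewrite ge0_fin_numE// (le_lt_trans _ Bfin)// le_measure// inE.
  apply: le_trans Bn; rewrite exprS mulrA ler_wpM2r//.
  rewrite mulr_natr mulr2n -fineD//; apply: fine_le => //.
    by rewrite fin_numD Cfin.
  by rewrite ge0_fin_numE.
have [n An] : exists n, fine (nu A) <= e * 2 ^+ n.
  exists (Num.truncn (fine (nu A) / e)); rewrite -ler_pdivrMl//.
  rewrite mulrC (le_trans (ltW (truncnS_gt _)))// -natrX ler_nat.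
  exact: ltn_expl.
have [B [mB BA B0 Bn]] := H n; exists B; split => //.
have Bfin : nu B \is a fin_num.
  by rewrite ge0_fin_numE// (le_lt_trans _ Afin)// le_measure// inE.
rewrite B0/= -(fineK Bfin) lee_fin -(ler_pM2r (_ : 0 < 2 ^+ n))//.
exact: le_trans An.
Qed.

(* A set of maximal measure satisfying P is obtained as a countable union;
   its complement is null since it has no small subset of positive measure. *)
Lemma nonatomic_ind (P : set T -> Prop) (e : R) :
  (nu [set: T] < +oo)%E -> 0 < e ->
  (forall A B, measurable A -> measurable B -> P A -> P B -> P (A `|` B)) ->
  (forall A, measurable A -> (nu A <= e%:E)%E -> P A) ->
  P [set: T].
Proof.
move=> Tfin e0 PU Psmall.
have lty A : measurable A -> (nu A < +oo)%E.
  by move=> mA; rewrite (le_lt_trans _ Tfin)// le_measure// inE.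
have fin A : measurable A -> nu A \is a fin_num.
  by move=> mA; rewrite ge0_fin_numE// lty.
pose S := [set fine (nu A) | A in [set A | measurable A /\ P A]].
have S0 : has_sup S.
  split.
    by exists 0, set0; rewrite ?measure0//; split => //; apply: Psmall;
      rewrite ?measure0// lee_fin ltW.
  by exists (fine (nu [set: T])) => _ [A [mA PA] <-];
    rewrite fine_le ?fin// le_measure// inE.
have Sub A : measurable A -> P A -> fine (nu A) <= sup S.
  by move=> mA PA; apply: ub_le_sup; [exact: S0.2|exists A].
have /choice[A HA] : forall n : nat, exists A,
    [/\ measurable A, P A & sup S - n.+1%:R^-1 < fine (nu A)].
  move=> n; have [|_ [A [mA PA] <-] lt] := @sup_adherent _ S n.+1%:R^-1 _ S0.
    by rewrite invr_gt0.
  by exists A.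
have mA n : measurable (A n) by have [] := HA n.
pose U := fun n => \big[setU/set0]_(i < n) A i.
have mU n : measurable (U n) by apply: bigsetU_measurable => i _.
have PUn n : P (U n).
  rewrite /U; elim: n => [|n IH].
    by rewrite big_ord0; apply: Psmall => //; rewrite measure0 lee_fin ltW.
  by rewrite big_ord_recr; apply: PU => //; [exact: mU|have [] := HA n].
pose W := \bigcup_n U n.
have mW : measurable W by exact: bigcupT_measurable.
have WS : (nu W <= (sup S)%:E)%E.
  have cv : nu \o U @ \oo --> nu W.
    by apply: nondecreasing_cvg_mu => // m n mn; apply/subsetPset;
      exact: subset_bigsetU.
  rewrite -(cvg_lim _ cv)//; apply: lime_le; first by apply/cvg_ex; exists (nu W).
  by apply: nearW => n /=; rewrite -(fineK (fin _ (mU n))) lee_fin Sub.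
have AW n : A n `<=` W.
  by move=> x Ax; exists n.+1 => //; rewrite /U big_ord_recr; right.
have inv_small (r : R) : 0 < r -> exists n : nat, n.+1%:R^-1 <= r.
  move=> r0; exists (Num.truncn r^-1).
  by rewrite invf_ple ?posrE// ltW// truncnS_gt.
(* [P] need not pass to countable unions. But [nu W <= sup S], so what [W] adds to a near-maximal
   [A n] has measure at most [e] and falls under [Psmall]. *)
have PW : P W.
  have [n ne] := inv_small e e0; have [_ PA An] := HA n.
  rewrite -(setDUK (AW n)); apply: PU => //; first exact: measurableD.
  apply: Psmall; first exact: measurableD.
  rewrite measureD// ?ltey_eq ?fin// (setIidr (AW n)).
  rewrite leeBlDr ?fin// (le_trans WS)//.
  rewrite -[X in (_ + X)%E]fineK ?fin// -EFinD lee_fin -lerBlDl.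
  by apply: le_trans (ltW An); rewrite lerB.
(* A small [B] of positive measure outside [W] would give the union of [W] and [B], which satisfies
   [P], a measure above [sup S]. *)
have WC0 : nu (~` W) = 0%E.
  apply/eqP; rewrite eq_le measure_ge0 andbT leNgt; apply/negP => WC.
  have mWC : measurable (~` W) by exact: measurableC.
  have [B [mB BW /andP[B0 Be]]] := nonatomic_small mWC WC
    (lty _ mWC) e0.
  have [|n nB] := inv_small (fine (nu B)); first by rewrite fine_gt0// B0 lty.
  have [_ _] := HA n; rewrite ltNge => /negP; apply.
  rewrite lerBrDr (le_trans (lerD (lexx _) nB))//.
  have WB : W `&` B = set0 by rewrite -subset0 => x [Wx Bx]; exact: BW Bx Wx.
  apply: (@le_trans _ _ (fine (nu (W `|` B)))).
    rewrite measureU// fineD ?fin// lerD2r fine_le ?fin// le_measure// inE//.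
  by apply: Sub; [exact: measurableU|apply: PU => //; exact: Psmall].
by rewrite -(setUv W); apply: PU => //; [exact: measurableC|apply: Psmall;
  [exact: measurableC|rewrite WC0 lee_fin ltW]].
Qed.
End nonatomic_measure.

(** * Sets of finite positive measure, and measures with a density *)

Section density.
Context d (T : measurableType d) (R : realType).
Variable mu : {measure set T -> \bar R}.

Lemma sigma_finite_ex_pos : sigma_finite [set: T] mu -> (0 < mu [set: T])%E ->
  exists A, [/\ measurable A, (0 < mu A)%E & (mu A < +oo)%E].
Proof.
move=> [F FT mF] T0; apply: contrapT => H.
have F0 n : mu (F n) = 0%E.
  apply/eqP; rewrite eq_le measure_ge0 andbT leNgt; apply/negP => F0.
  by apply: H; exists (F n); split => //; have [] := mF n.
have : mu.-negligible [set: T].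
  rewrite FT; apply: negligible_bigcup => n.
  by apply/negligibleP; [have [] := mF n|exact: F0].
by move=> /(negligibleP mu measurableT) /= T00; rewrite T00 ltxx in T0.
Qed.

Variable f : T -> R.

(** The proof [mf] is an argument so that the measure instance below, whose additivity rests on it,
    can be inferred from the term. *)
Definition density (mf : measurable_fun [set: T] f) (A : set T) : \bar R :=
  (\int[mu]_(x in A) `|f x|%:E)%E.

Hypothesis mf : measurable_fun [set: T] f.
Local Notation nu := (density mf).

Let mnf (A : set T) : measurable_fun A (fun x => `|f x|%:E).
Proof.
apply/measurable_EFinP; apply: measurableT_comp => //.
exact: measurable_funTS.
Qed.

Let density0 : nu set0 = 0%E. Proof. exact: integral_set0. Qed.

Let density_ge0 A : (0 <= nu A)%E.
Proof. by apply: integral_ge0 => x _; rewrite lee_fin. Qed.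

Let density_sigma_additive : semi_sigma_additive nu.
Proof. by apply: semi_sigma_additive_nng_induced. Qed.

HB.instance Definition _ := isMeasure.Build _ _ _ nu
  density0 density_ge0 density_sigma_additive.

Lemma density_gt0 (B : set T) : measurable B -> (0 < mu B)%E ->
  (forall x, B x -> f x != 0) -> (0 < nu B)%E.
Proof.
move=> mB B0 Bf; rewrite lt_def density_ge0 andbT; apply/eqP => nuB.
have [+ _] := ae_eq_integral_abs mu mB (mnf (A := B)).
rewrite (_ : (\int[mu]_(x in B) _)%E = 0%E); last first.
  by rewrite -nuB; apply: eq_integral => x _; rewrite /= normr_id.
move=> /(_ erefl) ae0.
suff : mu.-negligible B by move=> /(negligibleP mu mB) B00; rewrite B00 ltxx in B0.
apply: negligibleS ae0 => x Bx /= /(_ Bx) [] /eqP.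
by rewrite normr_eq0; exact/negP/Bf.
Qed.

(** [nu] lives on the set [Z] where [f] does not vanish, and there it has the same null sets as
    [mu]. So a splitting for [mu] of the part of [A] in [Z] also splits [A] for [nu]; finiteness of
    [nu] makes the inequality strict. *)
Lemma nonatomic_density : nonatomic mu -> (nu [set: T] < +oo)%E -> nonatomic nu.
Proof.
move=> mu_na fint A mA A0.
pose Z := [set x | f x != 0].
have mZ : measurable Z.
  rewrite (_ : Z = f @^-1` ~` [set 0]); last first.
    by apply/seteqP; split => x /= /eqP.
  by rewrite -[X in measurable X]setTI; apply: mf => //; exact: measurableC.
have AZ0 : nu (A `\` Z) = 0%E.
  by apply: integral0_eq => x [_ /negP]; rewrite negbK => /eqP ->; rewrite normr0.
have mAZ : measurable (A `&` Z) by exact: measurableI.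
have AE : nu A = nu (A `&` Z).
  by rewrite (measureDI nu mA mZ) /= AZ0 add0e.
have muAZ : (0 < mu (A `&` Z))%E.
  rewrite lt0e measure_ge0 andbT; apply/eqP => AZ.
  by move: A0; rewrite [X in (_ < X)%E]AE /density null_set_integral ?ltxx.
have [B [mB BAZ /andP[B0 BltA]]] := mu_na _ mAZ muAZ.
exists B; split => //; first by move=> x /BAZ [].
rewrite density_gt0//=; last by move=> x /BAZ [].
have mD : measurable ((A `&` Z) `\` B) by exact: measurableD.
have AZE (m : {measure set T -> \bar R}) :
    (m (A `&` Z) = m B + m ((A `&` Z) `\` B))%E.
  by rewrite addeC (measureDI m mAZ mB) (setIidr BAZ).
rewrite [X in (_ < X)%E]AE [X in (_ < X)%E](AZE nu) lteDl.
2: by rewrite ge0_fin_numE// (le_lt_trans _ fint)// le_measure// inE.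
apply: density_gt0 => //; last by move=> x [[]].
rewrite lt0e measure_ge0 andbT; apply/eqP => D0.
by move: BltA; rewrite (AZE mu) D0 adde0 ltxx.
Qed.

End density.

(** * Operator norm and classes of functions *)

Section opnorm.
Context (R : realType) (X : normedModType R).

Lemma opnorm_le (A : X -> X) (M : R) :
  (forall x, `|x| <= 1 -> `|A x| <= M) -> opnorm A <= M.
Proof.
move=> AM; apply: ge_sup; first by exists `|A 0|; exists 0; rewrite //= normr0.
by move=> _ [x x1 <-]; exact: AM.
Qed.

(** The crude bound [M] ensures that the supremum defining [opnorm] is taken over a bounded set;
    otherwise [sup] has the default value 0. *)
Lemma opnorm_ub (A : X -> X) (M : R) :
  (forall a x, A (a *: x) = a *: A x) -> (forall x, `|A x| <= M * `|x|) ->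
  forall x, `|A x| <= opnorm A * `|x|.
Proof.
move=> AZ AM x; have [->|x0] := eqVneq x 0.
  by rewrite -(scale0r (0 : X)) AZ !scale0r !normr0 mulr0.
have nx0 : 0 < `|x| by rewrite normr_gt0.
rewrite -ler_pdivrMr//; apply: ub_le_sup.
  exists `|M| => _ [z /= z1 <-]; rewrite (le_trans (AM z))//.
  by rewrite (le_trans (ler_norm _))// normrM normr_id ler_piMr.
exists (`|x|^-1 *: x) => /=.
  by rewrite normrZ normfV normr_id mulVf// gt_eqF.
by rewrite AZ normrZ normfV normr_id mulrC.
Qed.

End opnorm.

Section orlicz_restriction.
Context d (T : measurableType d) (R : realType).
Variables (mu : {measure set T -> \bar R}) (phi : orliczFunction R).

Lemma LorliczP (f : T -> R) : f \in Lorlicz mu phi <->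
  measurable_fun [set: T] f /\ finite_modular mu phi f.
Proof.
split; first by case/andP; rewrite !inE.
by case=> mf ff; apply/andP; rewrite !inE.
Qed.

Lemma le_finite_modular (f g : T -> R) : measurable_fun [set: T] f ->
  measurable_fun [set: T] g -> (forall x, `|f x| <= `|g x|) ->
  finite_modular mu phi g -> finite_modular mu phi f.
Proof.
move=> mf mg fg [l l0 lg]; exists l => //; apply: le_lt_trans lg.
apply: le_modular; [exact: measurable_funM|exact: measurable_funM|].
by move=> x; rewrite !normrM ler_wpM2l.
Qed.

Lemma Lorlicz_restrict (f : T -> R) (E : set T) : measurable E ->
  f \in Lorlicz mu phi -> (fun x => f x * \1_E x) \in Lorlicz mu phi.
Proof.
move=> mE /LorliczP[mf ff]; apply/LorliczP.
have mfE : measurable_fun [set: T] (fun x => f x * \1_E x).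
  exact: measurable_funM.
split=> //; apply: le_finite_modular ff => // x.
by rewrite normrM indicE; case: (x \in E); rewrite ?normr1 ?normr0 ?mulr1 ?mulr0.
Qed.

End orlicz_restriction.

Section orlicz_class.
Context d (T : measurableType d) (R : realType).
Variables (mu : {measure set T -> \bar R}) (phi : orliczFunction R).

Definition orlicz_class (f : LorliczFun mu phi) : OrliczSpace mu phi :=
  \pi_(OrliczSpace mu phi)%qT f.

Lemma orlicz_class_surj (x : OrliczSpace mu phi) : exists f, x = orlicz_class f.
Proof. exact: OrliczSpace_surj. Qed.

Lemma orlicz_classD f g :
  orlicz_class (f + g) = orlicz_class f + orlicz_class g.
Proof. by rewrite [RHS]OrliczSpace_piD. Qed.

Lemma orlicz_classZ a f : orlicz_class (a *: f) = a *: orlicz_class f.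
Proof. exact/esym/OrliczSpace_piZ. Qed.

Lemma orlicz_class_eqP f g : orlicz_class f = orlicz_class g <->
  {ae mu, forall x, val f x = val g x}.
Proof. exact: OrliczSpace_eqP. Qed.

Lemma norm_orlicz_class f :
  `|orlicz_class f| = luxemburg_norm mu phi (val f).
Proof. exact: OrliczSpace_norm_pi. Qed.

Lemma LorliczFun_ex (f : T -> R) : measurable_fun [set: T] f ->
  finite_modular mu phi f -> exists g : LorliczFun mu phi, val g = f.
Proof.
move=> mf ff; have Lf : f \in Lorlicz mu phi by apply/LorliczP.
by exists (Sub f Lf); rewrite SubK.
Qed.

Lemma LorliczFun_restrict (f : LorliczFun mu phi) (E : set T) : measurable E ->
  exists g : LorliczFun mu phi, val g = (fun x => val f x * \1_E x).
Proof.
move=> mE; have /LorliczP[mfE ffE] := Lorlicz_restrict mE (valP f).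
exact: LorliczFun_ex.
Qed.

End orlicz_class.

(** * Additivity of the norm in an isometric copy of L_1 *)

Section L1_norm.
Context d (T : measurableType d) (R : realType).
Variables (mu : {measure set T -> \bar R}) (phi : orliczFunction R) (k : R).
Hypothesis iso : orlicz_isometric_L1 mu phi k.

Let N1 (f : T -> R) : R := (\int[mu]_x `|f x|)%R.

Lemma isometric_integrable (f : T -> R) : f \in Lorlicz mu phi ->
  mu.-integrable [set: T] (EFin \o f).
Proof. by move/(iso.1 f)/Lfun1_integrable. Qed.

Let integrable_normr (f : T -> R) : f \in Lorlicz mu phi ->
  mu.-integrable [set: T] (EFin \o (fun x => `|f x|)).
Proof. by move/isometric_integrable/integrable_norm. Qed.

Lemma isometric_norm (f : LorliczFun mu phi) :
  `|orlicz_class f| = k * N1 (val f).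
Proof.
rewrite norm_orlicz_class.
have [_ /(_ (val f) (valP f))] := iso.
rewrite Lnorm1 /N1 /Rintegral.
have := integrable_fin_num measurableT (integrable_normr (valP f)).
by move=> /= fin; rewrite -[X in (_ * X)%E]fineK// -EFinM => -[].
Qed.

Let Norm_disjoint (g g1 g2 : LorliczFun mu phi) :
  (forall x, `|val g x| = `|val g1 x| + `|val g2 x|) ->
  N1 (val g) = N1 (val g1) + N1 (val g2).
Proof.
move=> gE; rewrite /N1 -RintegralD//; last 2 first.
- exact: integrable_normr (valP g1).
- exact: integrable_normr (valP g2).
by apply: eq_Rintegral => x _; rewrite gE.
Qed.

(** The two pieces have disjoint supports, so their L_1 norms add. This lets the bound tested in
    [isometric_daugavet] pass to unions. *)
Lemma isometric_norm_split (h g g1 g2 : LorliczFun mu phi) (F A : set T) :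
  val g = (fun x => val h x * \1_F x) ->
  val g1 = (fun x => val h x * \1_(F `&` A) x) ->
  val g2 = (fun x => val h x * \1_(F `\` A) x) ->
  g = g1 + g2 /\ N1 (val g) = N1 (val g1) + N1 (val g2).
Proof.
move=> gE g1E g2E; split.
  apply: val_inj; rewrite linearD/= gE g1E g2E; apply/funext => x /=.
  rewrite fctE -mulrDr; congr (_ * _); rewrite !indicE in_setI in_setD.
  by case: (x \in F); case: (x \in A); rewrite ?addr0 ?add0r.
apply: Norm_disjoint => x; rewrite gE g1E g2E !normrM -mulrDr; congr (_ * _).
rewrite !indicE in_setI in_setD.
by case: (x \in F); case: (x \in A); rewrite /= ?normr1 ?normr0 ?addr0 ?add0r.
Qed.

(** Outside [E] only [a *: y] is present; on [E] the triangle inequality gives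
    [|g| + |a y| <= |g + a y| + 2 |a y|]. If [y] has little mass on [E], the norm of the sum is thus
    nearly the sum of the norms. *)
Lemma isometric_norm_perturb (g y : LorliczFun mu phi) (a : R) (E : set T) :
  measurable E -> (forall x, ~ E x -> val g x = 0) ->
  N1 (val g) + `|a| * N1 (val y) <=
  N1 (val (g + a *: y)) + 2 * `|a| * (\int[mu]_(x in E) `|val y x|)%R.
Proof.
move=> mE gE; have ig := integrable_normr (valP g).
have iy := integrable_normr (valP y).
have iya : mu.-integrable [set: T] (EFin \o (fun x => `|a| * `|val y x|)).
  exact: (integrableZl measurableT _ iy).
have is_ := integrable_normr (valP (g + a *: y)).
have iyE : mu.-integrable [set: T]
    (EFin \o ((fun x => `|val y x|) \_ E)).
  rewrite -restrict_EFin; apply/(integrable_mkcond _ mE).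
  exact: (integrableS measurableT mE (@subsetT _ _) iy).
have iyE2 : mu.-integrable [set: T]
    (EFin \o (fun x => 2 * `|a| * ((fun x => `|val y x|) \_ E) x)).
  exact: (integrableZl measurableT _ iyE).
rewrite /N1 [X in _ <= _ + _ * X]Rintegral_mkcond.
rewrite -(RintegralZl _ measurableT iy) -(RintegralZl _ measurableT iyE).
rewrite -(RintegralD measurableT ig iya) -(RintegralD measurableT is_ iyE2).
apply: le_Rintegral => //; [exact: (integrableD measurableT ig iya)|
  exact: (integrableD measurableT is_ iyE2)|].
move=> x _; change (`|val g x| + `|a| * `|val y x| <=
  `|val g x + a * val y x| + 2 * `|a| * ((fun x => `|val y x|) \_ E) x).
rewrite patchE.
have [Ex|Ex] := boolP (x \in E).
  have := ler_normB (val g x + a * val y x) (a * val y x).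
  rewrite addrK normrM; lra.
rewrite gE; last by move: Ex; rewrite notin_setE.
by rewrite normr0 mulr0 !add0r addr0 normrM.
Qed.

End L1_norm.

(** * Isometric copies of L_1 have the Daugavet property *)

Section isometric_daugavet.
Context d (T : measurableType d) (R : realType).
Variables (mu : {measure set T -> \bar R}) (phi : orliczFunction R) (k : R).
Hypotheses (k0 : 0 < k) (iso : orlicz_isometric_L1 mu phi k).
Hypothesis mu_nonatomic : nonatomic mu.

Local Notation X := (OrliczSpace mu phi).
Local Notation cls := (@orlicz_class _ _ _ mu phi).

Lemma isometric_daugavet : daugavet_property X.
Proof.
move=> A /linear_boundedP [M [_ /(_ (M + 1)) AM]] [y y0 rangeA].
have {}AM x : `|A x| <= (M + 1) * `|x| by apply: AM; rewrite ltrDl.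
have AZ a x : A (a *: x) = a *: A x by rewrite linearZ.
have AN := opnorm_ub AZ AM.
set N := opnorm A in AN *.
have N0 : 0 <= N.
  by have := AN y; rewrite -ler_pdivrMr ?normr_gt0//; apply: le_trans;
    rewrite divr_ge0.
have BN x : `|x + A x| <= (1 + N) * `|x|.
  by rewrite (le_trans (ler_normD _ _))// mulrDl mul1r lerD2l.
have BZ a x : a *: x + A (a *: x) = a *: (x + A x) by rewrite linearZ scalerDr.
have BS := opnorm_ub BZ BN.
apply/eqP; rewrite eq_le; apply/andP; split.
  by apply: opnorm_le => x x1; rewrite (le_trans (BN x))// ler_piMr// addr_ge0.
set S := opnorm _ in BS *.
rewrite leNgt; apply/negP => SN.
(* Half the assumed defect: one [e] pays for [h] not attaining the norm of [A], the other for the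
   overlap of a piece of [h] with [y]. *)
pose e := (1 + N - S) / 2.
have e0 : 0 < e by rewrite divr_gt0// subr_gt0.
have SE : S = 1 + (N - e) - e by rewrite /e; field.
have [h hA] : exists h : LorliczFun mu phi, (N - e) * `|cls h| < `|A (cls h)|.
  apply: contrapT => H.
  have {}H x : `|A x| <= (N - e) * `|x|.
    have [f ->] := orlicz_class_surj x; rewrite leNgt; apply/negP => Hf.
    by apply: H; exists f.
  have Ne : 0 <= N - e.
    by have := H y; rewrite -ler_pdivrMr ?normr_gt0//; apply: le_trans;
      rewrite divr_ge0.
  have : N <= N - e.
    by apply: opnorm_le => x x1; rewrite (le_trans (H x))// ler_piMr.
  by rewrite lerBrDr gerDl leNgt e0.
have [fy yE] := orlicz_class_surj y.
have [mfy ffy] := LorliczFunP fy.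
have iy := isometric_integrable iso (valP fy).
pose nu := density mu mfy.
have nuy : nu = (fun E => \int[mu]_(x in E) `|(EFin \o val fy) x|)%E by [].
have nufin E : measurable E -> nu E \is a fin_num.
  move=> mE; rewrite ge0_fin_numE ?integral_ge0// nuy.
  by have := integrableS measurableT mE (@subsetT _ _) iy; case/integrableP.
(* [P E] says that no restriction of [h] inside [E] beats the ratio [N - e]. Quantifying over all
   [F] inside [E] makes [P] stable under unions, and [P] of the whole space contradicts the choice
   of [h]. *)
pose P E := forall F (g : LorliczFun mu phi), measurable F -> F `<=` E ->
  val g = (fun x => val h x * \1_F x) -> `|A (cls g)| <= (N - e) * `|cls g|.
suff PT : P [set: T].
  move: hA; rewrite ltNge => /negP; apply.
  apply: (PT [set: T] h measurableT (@subsetT _ _)).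
  by apply/funext => x; rewrite indicE in_setT mulr1.
have nuT : (nu [set: T] < +oo)%E by rewrite -ge0_fin_numE ?nufin// integral_ge0.
have N1 : 0 < 2 * N + 1 by rewrite ltr_wpDl// mulr_ge0.
(* Since [|a| * |y| <= N * |g|], this size makes the overlap term of [isometric_norm_perturb], times
   [k], at most [e * |g|]; the [+ 1] keeps the denominator positive when [N = 0]. *)
pose del := e * `|y| / (2 * N + 1) / k.
have del0 : 0 < del.
  by rewrite !divr_gt0// mulr_gt0 ?normr_gt0.
apply: (@nonatomic_ind _ _ _ (density mu mfy) _ P del) => //.
- exact: nonatomic_density.
- move=> B C mB mC PB PC F g mF FBC gE.
  have mFB : measurable (F `&` B) by exact: measurableI.
  have mFB' : measurable (F `\` B) by exact: measurableD.
  have [g1 g1E] := LorliczFun_restrict h mFB.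
  have [g2 g2E] := LorliczFun_restrict h mFB'.
  have [gD nD] := isometric_norm_split iso gE g1E g2E.
  have PD : `|cls g| = `|cls g1| + `|cls g2|.
    by rewrite !(isometric_norm iso) nD mulrDr.
  have -> : cls g = cls g1 + cls g2 by rewrite gD orlicz_classD.
  rewrite linearD (le_trans (ler_normD _ _))//.
  rewrite -orlicz_classD -gD PD mulrDr lerD//.
  + by apply: (PB (F `&` B)).
  + by apply: (PC (F `\` B)) => // x [/FBC[]].
- move=> E mE nuE F g mF FE gE.
  have [a Aa] : exists a, A (cls g) = a *: y.
    have : range A (A (cls g)) by exists (cls g).
    by rewrite rangeA => -[a _ <-]; exists a.
  have gE0 x : ~ E x -> val g x = 0.
    move=> Ex; rewrite gE indicE memNset ?mulr0// => /FE; exact: Ex.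
  have := isometric_norm_perturb iso fy a mE gE0.
  rewrite -(ler_pM2l k0) !mulrDr mulrCA -!(isometric_norm iso).
  rewrite orlicz_classD orlicz_classZ -yE -Aa.
  have -> : `|a| * `|y| = `|A (cls g)| by rewrite Aa normrZ.
  have rE : k * (\int[mu]_(x in E) `|val fy x|) <= e * `|y| / (2 * N + 1).
    rewrite mulrC -ler_pdivlMr// -lee_fin fineK//.
    exact: nufin.
  have aN : `|a| * `|y| <= N * `|cls g| by rewrite -normrZ -Aa AN.
  have := BS (cls g); rewrite SE.
  have : k * (2 * `|a| * (\int[mu]_(x in E) `|val fy x|)) <= e * `|cls g|.
    rewrite mulrCA (le_trans (ler_wpM2l _ rE)) ?mulr_ge0//.
    rewrite mulrA ler_pdivrMr//.
    have -> : 2 * `|a| * (e * `|y|) = e * (2 * (`|a| * `|y|)) by ring.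
    rewrite -[leRHS]mulrA ler_pM2l// mulrDr mulr1 ler_wpDr//.
    by rewrite [leRHS]mulrCA ler_pM2l// [leRHS]mulrC.
  move=> qe wS uv; rewrite -(lerD2l `|cls g|) (le_trans uv)//.
  rewrite (le_trans (lerD wS qe))// le_eqVlt; apply/orP; left; apply/eqP.
  by ring.
Qed.
End isometric_daugavet.

(** * Linear Orlicz functions give L_1 *)

Section linear_orlicz.
Context d (T : measurableType d) (R : realType).
Variables (mu : {measure set T -> \bar R}) (phi : orliczFunction R) (k : R).
Hypotheses (k0 : 0 < k) (phiE : forall u : R, 0 <= u -> phi u = (k * u)%:E).

Lemma linear_modular (c : R) (f : T -> R) : measurable_fun [set: T] f ->
  orlicz_modular mu phi (fun x => c * f x) =
  ((k * `|c|)%:E * \int[mu]_x `|f x|%:E)%E.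
Proof.
move=> mf; rewrite -ge0_integralZl//; last 2 first.
- by apply/measurable_EFinP; exact: measurableT_comp.
- by rewrite lee_fin mulr_ge0// ltW.
by apply: eq_integral => x _; rewrite phiE// normrM mulrA.
Qed.

Lemma linear_Lorlicz (f : T -> R) :
  f \in Lorlicz mu phi <-> mu.-integrable [set: T] (EFin \o f).
Proof.
split=> [/LorliczP[mf [l l0]]|/integrableP[/measurable_EFinP mf fin]].
  rewrite linear_modular// => fin; apply/integrableP; split.
    exact/measurable_EFinP.
  have kl0 : 0 < k * `|l| by rewrite mulr_gt0// gtr0_norm.
  rewrite /= ltNge leye_eq; apply/eqP => infty; move: fin.
  by rewrite infty gt0_muley ?lte_fin.
apply/LorliczP; split => //; exists 1 => //; rewrite linear_modular//.
by rewrite lte_mul_pinfty// lee_fin mulr_ge0// ltW.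
Qed.

(** The modular of [f / e] is [k / e] times the L_1 norm of [f], so the admissible [e] are the
    positive ones that are at least [k] times that norm. *)
Lemma linear_isometric_L1 : orlicz_isometric_L1 mu phi k.
Proof.
split=> f.
  by split=> [/linear_Lorlicz/Lfun1_integrable|/Lfun1_integrable/linear_Lorlicz].
move=> Lf; have /LorliczP[mf ff] := Lf.
rewrite Lnorm1; have /integrableP[_ /= fin] := (linear_Lorlicz f).1 Lf.
have finE : (\int[mu]_x `|f x|%:E)%E \is a fin_num.
  by rewrite ge0_fin_numE// integral_ge0.
rewrite -(fineK finE) -EFinM; congr EFin.
set a := fine _.
have a0 : 0 <= a by rewrite fine_ge0// integral_ge0.
have modE e : 0 < e ->
    orlicz_modular mu phi (fun x => f x / e) = (k * a / e)%:E.
  move=> e0; under [fun x => _]eq_fun do rewrite mulrC.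
  rewrite linear_modular// -(fineK finE) -EFinM normfV gtr0_norm//.
  by rewrite mulrAC.
apply/eqP; rewrite eq_le; apply/andP; split.
  (* Candidates for the Luxemburg norm must be positive, while [k * a] may be 0; hence the extra
     [e]. *)
  apply/ler_addgt0Pl => e e0.
  have eka : 0 < e + k * a by rewrite ltr_wpDr// mulr_ge0// ltW.
  apply: luxemburg_le; split => //; rewrite modE// lee_fin ler_pdivrMr// mul1r.
  by rewrite lerDr ltW.
apply: (@luxemburg_ge _ _ _ mu phi) => // e [e0]; rewrite modE// lee_fin.
by rewrite ler_pdivrMr// mul1r.
Qed.

End linear_orlicz.

(** * Convex functions on the half-line *)

Section convex_halfline.
Context (R : realType).
Variable p : R -> R.
Hypotheses (p_ge0 : forall u, 0 <= u -> 0 <= p u) (p0 : p 0 = 0).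
Hypothesis p_convex : forall t u v : R, 0 <= t <= 1 -> 0 <= u -> 0 <= v ->
  p (t * u + (1 - t) * v) <= t * p u + (1 - t) * p v.

(** Slopes of consecutive chords increase: convexity at [y] as a combination of [x] and [z], with
    denominators cleared. *)
Lemma convex_chord (x y z : R) : 0 <= x -> x < y -> y < z ->
  (p y - p x) * (z - y) <= (p z - p y) * (y - x).
Proof.
move=> x0 xy yz; have zx : 0 < z - x by rewrite subr_gt0 (lt_trans xy).
have z0 : 0 <= z by rewrite (le_trans x0)// ltW// (lt_trans xy).
pose t := (z - y) / (z - x).
have t01 : 0 <= t <= 1.
  by rewrite divr_ge0 ?(ltW zx) ?subr_ge0 ?(ltW yz)//= ler_pdivrMr// mul1r
    lerD2l lerN2 ltW.
have := p_convex t01 x0 z0.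
have -> : t * x + (1 - t) * z = y by rewrite /t; field; rewrite gt_eqF.
rewrite -(ler_pM2r zx) mulrDl mulrAC (_ : t * (z - x) = z - y); last first.
  by rewrite /t divfK// gt_eqF.
rewrite [X in _ <= _ + X]mulrAC (_ : (1 - t) * (z - x) = y - x); last first.
  by rewrite mulrBl mul1r /t divfK ?gt_eqF//; ring.
by move=> H; lra.
Qed.

(** Monotonicity of [p u / u], from convexity between 0 and [v]. *)
Lemma convex_contract (u v : R) : 0 <= u -> u <= v -> p u * v <= u * p v.
Proof.
move=> u0 uv; have [v0|] := ltP 0 v; last first.
  move=> v0; have -> : u = v by lra.
  by rewrite mulrC.
have t01 : 0 <= u / v <= 1 by rewrite divr_ge0 ?(ltW v0)//= ler_pdivrMr// mul1r.
have := p_convex t01 (ltW v0) (lexx 0).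
by rewrite mulr0 addr0 p0 mulr0 addr0 divfK ?gt_eqF// mulrAC ler_pdivlMr.
Qed.

Lemma convex_nondecreasing (u v : R) : 0 <= u -> u <= v -> p u <= p v.
Proof.
move=> u0 uv; have [v0|v0] := ltP 0 v; last by have -> : u = v by lra.
have v0' := ltW v0; rewrite -(ler_pM2r v0) (le_trans (convex_contract u0 uv))//.
by rewrite mulrC ler_wpM2l// p_ge0.
Qed.

(** The slope is the supremum of the chord slopes to the left of [c]; by [convex_chord] each chord
    slope to the right bounds them all. *)
Lemma convex_support_line (c : R) : 0 < c ->
  exists s, forall w, 0 <= w -> p c + s * (w - c) <= p w.
Proof.
move=> c0.
pose S := [set (p c - p w) / (c - w) | w in [set w | 0 <= w < c]].
have Sub z : c < z -> ubound S ((p z - p c) / (z - c)).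
  move=> cz _ [w /andP[w0 wc] <-].
  rewrite ler_pdivrMr ?subr_gt0// mulrAC ler_pdivlMr ?subr_gt0//.
  exact: convex_chord.
have S0 : has_sup S.
  split; first by exists ((p c - p 0) / (c - 0)), 0; rewrite //= lexx.
  by exists ((p (c + 1) - p c) / (c + 1 - c)); apply: Sub; rewrite ltrDl.
exists (sup S) => w w0; have [wc|cw|->] := ltgtP w c; last by rewrite subrr mulr0 addr0.
- have : (p c - p w) / (c - w) <= sup S.
    by apply: ub_le_sup; [exact: S0.2|exists w => //=; rewrite w0].
  by rewrite ler_pdivrMr ?subr_gt0//; move=> H; lra.
- have : sup S <= (p w - p c) / (w - c) by apply: ge_sup; [exact: S0.1|exact: Sub].
  by rewrite ler_pdivlMr ?subr_gt0//; move=> H; lra.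
Qed.

(** The chord over [[c, c + 1]] is at least as steep as any chord to the left of [c]. *)
Lemma convex_lipschitz (c x y : R) : 0 <= x -> x <= y -> y <= c ->
  p y - p x <= (p (c + 1) - p c) * (y - x).
Proof.
move=> x0; rewrite le_eqVlt => /orP[/eqP ->|xy yc]; first by rewrite !subrr mulr0.
have y0 : 0 <= y by rewrite (le_trans x0)// ltW.
have yc1 : y < c + 1 by rewrite (le_lt_trans yc)// ltrDl.
have H1 := convex_chord x0 xy yc1.
have : p (c + 1) - p y <= (p (c + 1) - p c) * (c + 1 - y).
  move: yc; rewrite le_eqVlt => /orP[/eqP <-|yc].
    by rewrite addrAC subrr add0r mulr1.
  have := @convex_chord y c (c + 1) y0 yc; rewrite ltrDl ltr01 => /(_ isT).
  by move=> H; lra.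
have cy : 0 < c + 1 - y by rewrite subr_gt0.
rewrite -(ler_pM2r (_ : 0 < y - x)) ?subr_gt0// => H2.
by rewrite -(ler_pM2r cy) (le_trans H1)// (le_trans H2)// mulrAC.
Qed.

(** Intermediate values: [c] is the supremum of the points where [p <= m], a bounded set because [p]
    grows at least linearly beyond [v]. The Lipschitz bound excludes both strict inequalities at
    [c]. *)
Lemma convex_value (v m : R) : 0 < v -> 0 < p v -> p v < m ->
  exists2 c, v < c & p c = m.
Proof.
move=> v0 pv vm.
pose S := [set w | 0 <= w /\ p w <= m].
have Sub w : S w -> w <= m * v / p v.
  move=> [w0 pw]; rewrite ler_pdivlMr//; have [vw|wv] := leP v w.
    have := convex_contract (ltW v0) vw.
    have : v * p w <= v * m by rewrite ler_pM2l.
    by move=> *; lra.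
  have : w * p v <= v * p v by rewrite ler_pM2r// ltW.
  have : v * p v <= v * m by rewrite ler_pM2l// ltW.
  by move=> *; lra.
have S0 : has_sup S.
  by split; [exists v; split; exact: ltW|exists (m * v / p v) => w /Sub].
set c := sup S.
have Sc w : S w -> w <= c by move=> Sw; apply: ub_le_sup => //; exact: S0.2.
have vc : v <= c by apply: Sc; split; exact: ltW.
have c0 : 0 < c by exact: lt_le_trans vc.
(* A Lipschitz constant on [[0, c + 1]], so that it also covers points just to the right of [c]. *)
pose L := p (c + 1 + 1) - p (c + 1).
have L0 : 0 <= L by rewrite subr_ge0 convex_nondecreasing// ?lerDl//; lra.
have pcm : p c = m.
  apply/eqP; rewrite eq_le; apply/andP; split; rewrite leNgt; apply/negP => H.
    pose e := (p c - m) / (L + 1).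
    have e0 : 0 < e by rewrite divr_gt0//; lra.
    have eE : p c - m = e * (L + 1) by rewrite /e divfK// gt_eqF//; lra.
    have [w [w0 pw] wc] := sup_adherent e0 S0; rewrite -/c in wc.
    have wc' : w <= c by apply: Sc.
    have cc1 : c <= c + 1 by rewrite lerDl.
    have := convex_lipschitz w0 wc' cc1; rewrite -/L.
    have : L * (c - w) <= L * e by rewrite ler_wpM2l//; lra.
    by move=> *; lra.
  pose e := Num.min 1 ((m - p c) / (L + 1)).
  have e0 : 0 < e by rewrite lt_min ltr01/= divr_gt0//; lra.
  have e1 : e <= 1 by rewrite ge_min lexx.
  have eL : e * (L + 1) <= m - p c.
    by rewrite -ler_pdivlMr; [rewrite ge_min lexx orbT|lra].
  have ce : S (c + e).
    split; first by lra.
    have [cce ce1] : c <= c + e /\ c + e <= c + 1 by split; lra.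
    have := convex_lipschitz (ltW c0) cce ce1; rewrite -/L addrAC subrr add0r.
    by move=> *; lra.
  by have := Sc _ ce; lra.
exists c => //; rewrite lt_neqAle vc andbT; apply/eqP => cv.
by move: vm; rewrite cv pcm ltxx.
Qed.

(** The strict increase of [p w / w] from [u] to [v] persists up to [c]. A supporting line at [c]
    through the origin or above would lie above [p] at [u]. *)
Lemma convex_superlinear (u v c s : R) : 0 < u -> u < v ->
  p u * v < u * p v -> v <= c ->
  (forall w, 0 <= w -> p c + s * (w - c) <= p w) -> p c < s * c.
Proof.
move=> u0 uv puv vc sc; have v0 : 0 < v by exact: lt_trans uv.
have c0 : 0 < c by exact: lt_le_trans vc.
have pvc := convex_contract (ltW v0) vc.
have H1 : p u * c < u * p c.
  rewrite -(ltr_pM2r v0).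
  have H2 : p u * v * c < u * p v * c by rewrite ltr_pM2r.
  have H3 : u * (p v * c) <= u * (v * p c) by rewrite ler_pM2l.
  by lra.
have uc : 0 < c - u by lra.
rewrite -(ltr_pM2r uc).
have := sc u (ltW u0); rewrite -(ler_pM2r c0) => H4.
by lra.
Qed.

End convex_halfline.

(** * Averaging over a small set *)

Section luxemburg_order.
Context d (T : measurableType d) (R : realType).
Variables (mu : {measure set T -> \bar R}) (phi : orliczFunction R).
Local Notation nm := (luxemburg_norm mu phi).

Lemma le_luxemburg (f g : T -> R) : measurable_fun [set: T] f ->
  measurable_fun [set: T] g -> finite_modular mu phi g ->
  (forall x, `|f x| <= `|g x|) -> nm f <= nm g.
Proof.
move=> mf mg fg le; apply: luxemburg_ge => // e [e0 Ie].
apply: luxemburg_le; split => //; apply: le_trans Ie.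
apply: le_modular; [exact: measurable_funM|exact: measurable_funM|].
by move=> x; rewrite !normrM ler_wpM2r.
Qed.

Lemma luxemburg_le1 (f : T -> R) : (orlicz_modular mu phi f <= 1)%E -> nm f <= 1.
Proof.
move=> If; apply: luxemburg_le; split => //.
by rewrite (eq_modular mu phi (g := f))// => x; rewrite divr1.
Qed.

Lemma modular_finite (f : T -> R) : (orlicz_modular mu phi f <= 1)%E ->
  finite_modular mu phi f.
Proof.
move=> If; exists 1 => //.
rewrite (eq_modular mu phi (g := f)); last by move=> x; rewrite mul1r.
exact: le_lt_trans (ltry 1).
Qed.

Hypothesis phi_finite : finite_orlicz phi.

Lemma finite_orlicz_fineE (u : R) : 0 <= u -> phi u = (fine (phi u))%:E.
Proof.
by move=> u0; rewrite fineK// ge0_fin_numE ?orlicz_ge0// ltey; exact: phi_finite.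
Qed.

Lemma modular_indic (l : R) (H : set T) : 0 <= l -> measurable H ->
  orlicz_modular mu phi (fun x => l * \1_H x) = ((fine (phi l))%:E * mu H)%E.
Proof.
move=> l0 mH; rewrite -[in RHS](setIT H) -integral_indic// -ge0_integralZl//.
- apply: eq_integral => x _; rewrite -finite_orlicz_fineE// indicE.
  by case: (x \in H); rewrite /= ?mulr1 ?mulr0 ?mule1 ?mule0 ?normr0 ?orlicz0// ger0_norm.
- by apply/measurable_EFinP.
- by rewrite lee_fin fine_ge0// orlicz_ge0.
Qed.

Lemma finite_modular_indic (H : set T) : measurable H -> (mu H < +oo)%E ->
  finite_modular mu phi \1_H.
Proof.
move=> mH Hfin; exists 1 => //; rewrite modular_indic//.
by rewrite lte_mul_pinfty// lee_fin fine_ge0// orlicz_ge0.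
Qed.

Lemma luxemburg_indic_le (e : R) (H : set T) : 0 < e -> measurable H ->
  ((fine (phi e))%:E * mu H <= 1)%E -> nm \1_H <= e^-1.
Proof.
move=> e0 mH He; apply: luxemburg_le; split; first by rewrite invr_gt0.
rewrite (eq_modular mu phi (g := fun x => e * \1_H x)); last first.
  by move=> x; rewrite invrK mulrC.
by rewrite modular_indic// ltW.
Qed.

End luxemburg_order.

(** * The conditional expectation on [B] and the norm gap *)

Section conditional_expectation.
Context d (T : measurableType d) (R : realType).
Variables (mu : {measure set T -> \bar R}) (phi : orliczFunction R).
Hypothesis phi_finite : finite_orlicz phi.
Local Notation nm := (luxemburg_norm mu phi).
Local Notation I := (orlicz_modular mu phi).
Let p (u : R) : R := fine (phi u).

Variables (B : set T) (b c s : R).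
Hypotheses (mB : measurable B) (b0 : 0 < b) (muB : mu B = b%:E).
Hypotheses (c0 : 0 < c) (pcb : p c * b = 1).
Hypothesis support : forall w : R, 0 <= w -> p c + s * (w - c) <= p w.
Hypothesis gap : p c < s * c.

Let pc0 : 0 < p c.
Proof. by rewrite -(pmulr_lgt0 _ b0) pcb. Qed.

Let s0 : 0 < s.
Proof. by rewrite -(pmulr_lgt0 _ c0) (lt_trans pc0). Qed.

Let Bfin : (mu B < +oo)%E. Proof. by rewrite muB ltry. Qed.

Let integrable_cstB (k : R) : mu.-integrable B (EFin \o cst k).
Proof.
apply/integrableP; split; first exact/measurable_EFinP/measurable_cst.
have -> : (\int[mu]_(x in B) `|(EFin \o cst k) x| = `|k|%:E * mu B)%E.
  by rewrite -integral_cst.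
by rewrite lte_mul_pinfty.
Qed.

Section function_estimates.
Variable h : T -> R.
Hypotheses (mh : measurable_fun [set: T] h) (Ih : (I h <= 1)%E).

Let mhB : measurable_fun B h. Proof. exact: measurable_funTS. Qed.

Let mphB : measurable_fun B (EFin \o (fun x => p `|h x|)).
Proof.
apply/measurable_EFinP; apply: measurable_funTS.
exact: (measurableT_comp (fine_measurable measurableT) (measurable_modular phi mh)).
Qed.

Let intB_p_le1 : (\int[mu]_(x in B) (p `|h x|%R)%:E <= 1)%E.
Proof.
rewrite (le_trans _ Ih)// /orlicz_modular.
have -> : (\int[mu]_(x in B) (p `|h x|%R)%:E = \int[mu]_(x in B) phi `|h x|%R)%E.
  by apply: eq_integral => x _; rewrite -finite_orlicz_fineE.
apply: ge0_subset_integral => //; first exact: measurable_modular.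
by move=> x _; exact: orlicz_ge0.
Qed.

Let integrable_p : mu.-integrable B (EFin \o (fun x => p `|h x|)).
Proof.
apply/integrableP; split => //; rewrite (le_lt_trans _ (ltry 1))//.
rewrite (le_trans _ intB_p_le1)// le_eqVlt; apply/orP; left; apply/eqP.
by apply: eq_integral => x _ /=; rewrite ger0_norm// fine_ge0// orlicz_ge0.
Qed.

Let Rint_p_le1 : \int[mu]_(x in B) (p `|h x|) <= 1.
Proof.
rewrite /Rintegral -lee_fin fineK//; exact: (integrable_fin_num mB integrable_p).
Qed.

Let integrable_pk (k : R) : mu.-integrable B (EFin \o (fun x => p `|h x| + k)).
Proof.
exact: (integrableD mB integrable_p (integrable_cstB k)).
Qed.

(** The supporting line gives [s * |h| <= p |h| + s * c], and the right side is integrable on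
    [B]. *)
Lemma modular_integrable_on : mu.-integrable B (EFin \o h).
Proof.
have int2 := integrableZl mB s^-1 (integrable_pk (s * c)).
apply: le_integrable int2 => //; first exact/measurable_EFinP.
move=> x _ /=; rewrite lee_fin normrM [X in _ <= X * _]gtr0_norm ?invr_gt0//.
rewrite ler_pdivlMl// (le_trans _ (ler_norm _))//.
have := support (normr_ge0 (h x)). have := pc0; lra.
Qed.

(** Jensen's inequality: integrating the supporting line at [|h|] gives [s] times the integral at
    most [1 + (s * c - p c) * b], which is [s * c * b] because [p c * b = 1]. *)
Lemma modular_int_norm_le : \int[mu]_(x in B) `|h x| <= c * b.
Proof.
have ih := integrable_norm modular_integrable_on.
have : \int[mu]_(x in B) (s * `|h x|) <=
       \int[mu]_(x in B) (p `|h x| + (s * c - p c)).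
  apply: le_Rintegral => //; first exact: (integrableZl mB s ih).
  by move=> x _ /=; have := support (normr_ge0 (h x)); lra.
rewrite RintegralZl// RintegralD//; last exact: integrable_cstB.
rewrite Rintegral_cst// muB/= mulrBl pcb => H; rewrite -(ler_pM2l s0) mulrA.
by rewrite (le_trans H)//; have := Rint_p_le1; lra.
Qed.

(* Integrate [p |h| >= p c + s * (h - c) + (s * c - p c) / 2 * \1_H] over [B]. *)
Lemma modular_small_values (eta : R) (H := B `&` [set x | h x <= eta]) :
  eta = (s * c - p c) / (2 * s) ->
  measurable H /\ fine (mu H) * ((s * c - p c) / 2) <=
    s * (c * b - \int[mu]_(x in B) h x).
Proof.
move=> etaE; have ih := modular_integrable_on.
have mH : measurable H.
  apply: measurableI => //.
  rewrite (_ : [set x | _] = h @^-1` `]-oo, eta]%classic); last first.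
    by apply/seteqP; split=> x /=; rewrite in_itv.
  by rewrite -[X in measurable X]setTI; exact: mh.
split=> //; set g := (s * c - p c) / 2.
have g0 : 0 < g by rewrite divr_gt0// subr_gt0.
have iH : mu.-integrable B (EFin \o \1_H).
  apply: le_integrable (integrable_cstB 1) => //.
    by apply/measurable_EFinP; exact: measurable_indic.
  move=> x _ /=; rewrite lee_fin indicE.
  by case: (x \in H); rewrite ?normr0 ?normr1.
have isH : mu.-integrable B (EFin \o (fun x => s * h x)).
  exact: (integrableZl mB s ih).
have igH : mu.-integrable B (EFin \o (fun x => g * \1_H x)).
  exact: (integrableZl mB g iH).
have : \int[mu]_(x in B) (s * h x + g * \1_H x) <=
       \int[mu]_(x in B) (p `|h x| + (s * c - p c)).
  apply: le_Rintegral => //; first exact: (integrableD mB isH igH).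
  move=> x Bx /=; have Px := support (normr_ge0 (h x)).
  have p0 : 0 <= p `|h x| by rewrite fine_ge0// orlicz_ge0.
  have sh : s * h x <= s * `|h x| by rewrite ler_pM2l// ler_norm.
  rewrite indicE; case: (boolP (x \in H)) => [|_]; last first.
    by rewrite mulr0 addr0; lra.
  rewrite inE => -[_ /= hx]; rewrite mulr1.
  (* On [H] the left side is at most [2 * g = s * c - p c], so [p >= 0] suffices. *)
  have : s * h x <= s * eta by rewrite ler_pM2l.
  have -> : s * eta = g by rewrite etaE /g; field; rewrite gt_eqF.
  by rewrite /g; lra.
rewrite (RintegralD mB isH igH) (RintegralD mB integrable_p (integrable_cstB _)).
rewrite (RintegralZl _ mB ih) (RintegralZl _ mB iH) Rintegral_cst// muB/=.
have -> : \int[mu]_(x in B) \1_H x = fine (mu H).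
  rewrite /Rintegral integral_indic//; congr (fine (mu _)).
  by apply/setIidl => x [].
rewrite mulrBl pcb => H1; have := Rint_p_le1; rewrite mulrC; lra.
Qed.

End function_estimates.
Let avg (h : T -> R) : R := (\int[mu]_(x in B) h x) / b.

Let eta : R := (s * c - p c) / (2 * s).

Let Q : R := p (2 * c).

(** The first bound makes a mean above [c - eps] exceed [2 * eta]; the second makes the set where
    [h <= eta] so small that its indicator has norm at most [(2 * c)^-1]. *)
Let eps : R := Num.min (p c / s) ((s * c - p c) / (2 * s * b * (Q + 1))).

Let Q0 : 0 <= Q.
Proof. by rewrite fine_ge0// orlicz_ge0// mulr_ge0// ltW. Qed.

Let den0 : 0 < 2 * s * b * (Q + 1).
Proof. by rewrite !mulr_gt0// ltr_wpDl. Qed.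

Let eta0 : 0 < eta.
Proof. by rewrite divr_gt0 ?mulr_gt0// subr_gt0. Qed.

Let eps0 : 0 < eps.
Proof. by rewrite lt_min !divr_gt0// subr_gt0. Qed.

Let eps_eta : eps <= c - 2 * eta.
Proof.
have -> : c - 2 * eta = p c / s by rewrite /eta; field; rewrite gt_eqF.
by rewrite ge_min lexx.
Qed.

Let luxemburg_B : nm \1_B <= c^-1.
Proof. by apply: luxemburg_indic_le => //; rewrite muB -EFinM [_ * _]pcb. Qed.

Let finB : finite_modular mu phi \1_B.
Proof. exact: finite_modular_indic. Qed.

Let m1 (H : set T) : measurable H -> measurable_fun [set: T] (\1_H : T -> R).
Proof. by move=> mH; exact: measurable_indic. Qed.

(** With [luxemburg_B] this bounds the norm of the conditional expectation by 1. *)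
Lemma averaging_contraction (h : T -> R) : measurable_fun [set: T] h ->
  (I h <= 1)%E -> `|avg h| <= c.
Proof.
move=> mh Ih; rewrite normrM normfV (gtr0_norm b0) ler_pdivrMr//.
apply: le_trans (modular_int_norm_le mh Ih).
exact: (le_normr_Rintegral mB (modular_integrable_on mh Ih)).
Qed.

(* Rests on [|h - a \1_B| <= |h| + (a - 2 eta) \1_B + 2 eta \1_H], where
   [H] is the small part of [B] on which [h <= eta]. *)
Let averaging_gap_pos (h : T -> R) : measurable_fun [set: T] h ->
  (I h <= 1)%E -> c - eps < avg h ->
  nm (fun x => h x - avg h * \1_B x) <= 2 - eta / c.
Proof.
move=> mh Ih aeps; set a := avg h in aeps *.
have ac : a <= c by rewrite (le_trans (ler_norm _))// averaging_contraction.
have [mH muH] := modular_small_values mh Ih (erefl eta).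
set H := B `&` _ in mH muH.
have Hfin : (mu H < +oo)%E.
  by rewrite (le_lt_trans _ Bfin)// le_measure ?inE// => x [].
have HE : mu H = (fine (mu H))%:E by rewrite fineK// ge0_fin_numE.
(* The mean [a] is within [eps] of [c], so [muH] gives [m * (Q + 1) <= 1], where [Q] is
   [p (2 * c)]. *)
have nmH : nm \1_H <= (2 * c)^-1.
  apply: luxemburg_indic_le => //; first exact: mulr_gt0.
  rewrite HE -EFinM lee_fin; move: muH.
  have -> : \int[mu]_(x in B) h x = a * b by rewrite /a /avg divfK// gt_eqF.
  set m := fine _ => mg.
  have m0 : 0 <= m by rewrite fine_ge0.
  have ca : (c - a) * (2 * s * b * (Q + 1)) <= s * c - p c.
    rewrite -ler_pdivlMr//; have : eps <= (s * c - p c) / (2 * s * b * (Q + 1)).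
      by rewrite ge_min lexx orbT.
    by move: aeps; set w := _ / _; lra.
  have g0 : 0 < s * c - p c by rewrite subr_gt0.
  have mQ : m * (Q + 1) <= 1.
    rewrite -(ler_pM2r g0) mul1r (le_trans _ ca)//.
    have Q1 : 0 <= Q + 1 by rewrite addr_ge0.
    by move: (ler_wpM2r Q1 mg); lra.
  by rewrite -/(p (2 * c)) -/Q; lra.
have ffin : finite_modular mu phi h by exact: modular_finite.
have mnh : measurable_fun [set: T] (fun x => `|h x|) by exact: measurableT_comp.
have fnh : finite_modular mu phi (fun x => `|h x|).
  by apply: le_finite_modular ffin => // x; rewrite normr_id.
have mB' (k : R) : measurable_fun [set: T] (fun x => k * \1_B x).
  by apply: measurable_funM => //; exact: m1.
have mH' (k : R) : measurable_fun [set: T] (fun x => k * \1_H x).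
  by apply: measurable_funM => //; exact: m1.
have fB' (k : R) : finite_modular mu phi (fun x => k * \1_B x).
  by apply: finite_modularZ => //; exact: m1.
have fH : finite_modular mu phi \1_H by exact: finite_modular_indic.
have fH' (k : R) : finite_modular mu phi (fun x => k * \1_H x).
  by apply: finite_modularZ => //; exact: m1.
have a2 : 0 <= a - 2 * eta by rewrite subr_ge0; have := eps_eta; lra.
pose g := (fun x => (a - 2 * eta) * \1_B x) \+ (fun x => 2 * eta * \1_H x).
have mg : measurable_fun [set: T] g by exact: measurable_funD.
have fg : finite_modular mu phi g.
  have := finite_modular_comb 1 (mB' (a - 2 * eta)) (mH' (2 * eta)) (fB' _) (fH' _).
  by under [fun x => _]eq_fun do rewrite mul1r.
have mhg : measurable_fun [set: T] ((fun x => `|h x|) \+ g).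
  exact: measurable_funD.
have fhg : finite_modular mu phi ((fun x => `|h x|) \+ g).
  have := finite_modular_comb 1 mnh mg fnh fg.
  by under [fun x => _]eq_fun do rewrite mul1r.
apply: (@le_trans _ _ (nm ((fun x => `|h x|) \+ g))).
  apply: le_luxemburg => //.
    by apply: measurable_funB => //.
  move=> x; rewrite /g /= (le_trans _ (ler_norm _))//.
  have e0 : 0 < eta := eta0; have a0 : 0 <= a by move: a2; lra.
  have hx := normr_ge0 (h x); have [hl hr] := (ler_norm (h x), lerNnormlW (lexx `|h x|)).
  rewrite !indicE; have [Bx|nBx] := boolP (x \in B); last first.
    rewrite memNset ?mulr0 ?subr0 ?addr0//= => -[/mem_set Bx _].
    by rewrite Bx in nBx.
  have [Hx|nHx] := boolP (x \in H).
    by rewrite !mulr1 (le_trans (ler_normB _ _))// (ger0_norm a0); lra.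
  (* Here [h x] and [a] both exceed [eta], and their distance is their sum minus twice the smaller
     one. *)
  have eh : eta < h x.
    rewrite ltNge; apply/negP => he; move: nHx; rewrite notin_setE; apply.
    by split => //; rewrite inE in Bx.
  rewrite !mulr1 mulr0 addr0 ler_norml; apply/andP; split; lra.
apply: le_trans (luxemburgD mnh mg fnh fg) _.
have nh : nm (fun x => `|h x|) <= 1.
  apply: luxemburg_le1; rewrite (eq_modular mu phi (g := h))// => x.
  by rewrite normr_id.
have ng : nm g <= (a - 2 * eta) / c + 2 * eta / (2 * c).
  rewrite (le_trans (luxemburgD (mB' _) (mH' _) (fB' _) (fH' _)))//.
  rewrite !luxemburgZ//; [|exact: m1..].
  rewrite ger0_norm// (gtr0_norm (mulr_gt0 _ eta0))//.
  by rewrite lerD// ler_wpM2l// mulr_ge0// ltW.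
apply: le_trans (lerD nh ng) _.
have -> : 2 - eta / c = 1 + ((c - 2 * eta) / c + 2 * eta / (2 * c)).
  by field; rewrite gt_eqF.
by rewrite lerD2l lerD2r ler_pM2r ?invr_gt0// lerD2r.
Qed.

(** If [|avg h| <= c - eps], the triangle inequality already saves [eps / c]. Otherwise
    [averaging_gap_pos] applies to [h] or to [-h] and saves [eta / c]. *)
Lemma averaging_gap : exists2 delta, 0 < delta &
  forall h : T -> R, measurable_fun [set: T] h -> (I h <= 1)%E ->
    nm (fun x => h x - avg h * \1_B x) <= 2 - delta.
Proof.
exists (Num.min eps eta / c); first by rewrite divr_gt0// lt_min eps0 eta0.
have le_eps : Num.min eps eta / c <= eps / c.
  by rewrite ler_pM2r ?invr_gt0// ge_min lexx.
have le_eta : 2 - eta / c <= 2 - Num.min eps eta / c.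
  by rewrite lerD2l lerN2 ler_pM2r ?invr_gt0// ge_min lexx orbT.
move=> h mh Ih; have [ha|ha] := leP `|avg h| (c - eps); last first.
  have [h0|h0] := leP 0 (avg h).
    by apply: le_trans le_eta; apply: averaging_gap_pos => //; rewrite -(ger0_norm h0).
  have mNh : measurable_fun [set: T] (fun x => -1 * h x) by exact: measurable_funM.
  have avgN : avg (fun x => -1 * h x) = - avg h.
    rewrite /avg (RintegralZl _ mB (modular_integrable_on mh Ih)).
    by rewrite mulN1r mulNr.
  have INh : (I (fun x => -1 * h x)%R <= 1)%E.
    by rewrite (eq_modular mu phi (g := h))// => x; rewrite mulN1r normrN.
  have gapN : c - eps < avg (fun x => -1 * h x) by rewrite avgN -(ltr0_norm h0).
  apply: le_trans le_eta; apply: le_trans (averaging_gap_pos mNh INh gapN).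
  apply: le_luxemburg.
  - by apply: measurable_funB => //; apply: measurable_funM => //; exact: m1.
  - by apply: measurable_funB => //; apply: measurable_funM => //; exact: m1.
  - rewrite (_ : (fun x => _) =
        (fun x => - avg (fun x => -1 * h x) * \1_B x + -1 * h x)); last first.
      by apply/funext => x; rewrite [LHS]addrC -[X in X + _]mulNr.
    exact: (finite_modular_comb _ (m1 mB) mNh finB (modular_finite INh)).
  - by move=> x; rewrite avgN mulN1r -normrN opprD mulNr.
have -> : (fun x => h x - avg h * \1_B x) = h \+ (fun x => - avg h * \1_B x).
  by apply/funext => x /=; rewrite mulNr.
have mB' : measurable_fun [set: T] (fun x => - avg h * \1_B x).
  by apply: measurable_funM => //; exact: m1.
have fB' : finite_modular mu phi (fun x => - avg h * \1_B x).
  exact: (finite_modularZ (- avg h) (m1 mB) finB).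
apply: le_trans (luxemburgD mh mB' (modular_finite Ih) fB') _.
rewrite (luxemburgZ (- avg h) (m1 mB) finB) normrN.
have H1 : nm h <= 1 by exact: luxemburg_le1.
have H2 : `|avg h| * nm \1_B <= (c - eps) / c.
  apply: (@le_trans _ _ (`|avg h| / c)); first by rewrite ler_wpM2l.
  by rewrite ler_pM2r ?invr_gt0.
apply: le_trans (lerD H1 H2) _; rewrite mulrBl divff ?gt_eqF//.
by move: le_eps; set u := _ / c; set v := eps / c; lra.
Qed.

Local Notation X := (OrliczSpace mu phi).

Let integrable_on (f : T -> R) : measurable_fun [set: T] f ->
  finite_modular mu phi f -> mu.-integrable B (EFin \o f).
Proof.
move=> mf ff; have [e [e0 Ie]] := luxemburg_neq0 mf ff.
have mfe : measurable_fun [set: T] (fun x => f x / e) by exact: measurable_funM.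
have := integrableZl mB e (modular_integrable_on mfe Ie).
by apply: eq_integrable => // x _ /=; rewrite -EFinM mulrC divfK// gt_eqF.
Qed.

Let avgZ (k : R) (f : T -> R) : measurable_fun [set: T] f ->
  finite_modular mu phi f -> avg (fun x => k * f x) = k * avg f.
Proof.
move=> mf ff; rewrite /avg (RintegralZl _ mB (integrable_on mf ff)).
by rewrite mulrA.
Qed.

Let avgD (f g : T -> R) : measurable_fun [set: T] f ->
  measurable_fun [set: T] g -> finite_modular mu phi f ->
  finite_modular mu phi g -> avg (fun x => f x + g x) = avg f + avg g.
Proof.
move=> mf mg ff fg.
rewrite /avg (RintegralD mB (integrable_on mf ff) (integrable_on mg fg)).
by rewrite mulrDl.
Qed.

Let avg_ae (f g : T -> R) : measurable_fun [set: T] f ->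
  measurable_fun [set: T] g -> {ae mu, forall x, f x = g x} -> avg f = avg g.
Proof.
move=> mf mg fg; rewrite /avg /Rintegral; congr (fine _ / _).
apply: ae_eq_integral => //.
- by apply/measurable_EFinP; exact: measurable_funTS.
- by apply/measurable_EFinP; exact: measurable_funTS.
- by apply: filterS fg => x -> _.
Qed.

Let avg_indic : avg \1_B = 1.
Proof.
by rewrite /avg /Rintegral integral_indic// setIid muB divff// gt_eqF.
Qed.

Lemma averaging_not_daugavet : ~ daugavet_property X.
Proof.
have [J JE] := LorliczFun_ex (m1 mB) finB.
(* Minus the conditional expectation, computed on a representative; [A0E] shows that the choice is
   immaterial. *)
pose A0 (x : X) : X := - avg (val (repr x)) *: orlicz_class J.
have A0E (f : LorliczFun mu phi) :
    A0 (orlicz_class f) = - avg (val f) *: orlicz_class J.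
  congr (- _ *: _); apply: avg_ae.
  - exact: (LorliczFunP _).1.
  - exact: (LorliczFunP _).1.
  - by apply/orlicz_class_eqP; rewrite /orlicz_class reprK.
have A0lin : linear A0.
  move=> k x y; have [f ->] := orlicz_class_surj x.
  have [g ->] := orlicz_class_surj y.
  rewrite -orlicz_classZ -orlicz_classD !A0E scalerA -scalerDl.
  have [mf ff] := LorliczFunP f; have [mg fg] := LorliczFunP g.
  have -> : val (k *: f + g) = (fun x => k * val f x + val g x).
    by rewrite linearD linearZ.
  rewrite avgD//; last 2 first.
  - exact: measurable_funM.
  - exact: finite_modularZ.
  by rewrite avgZ// opprD mulrN.
pose A : {linear X -> X} := HB.pack A0 (GRing.isLinear.Build R X X *:%R A0 A0lin).
have J0 : orlicz_class J != 0.
  apply/eqP => J0; have : orlicz_class J = orlicz_class 0.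
    by rewrite J0 -(scale0r (0 : LorliczFun mu phi)) orlicz_classZ scale0r.
  move=> /orlicz_class_eqP J0ae; suff : mu B = 0%E.
    by move: b0; rewrite muB => /[swap] -[->]; rewrite ltxx.
  apply/(negligibleP mu mB); apply: negligibleS J0ae => x Bx /=.
  by rewrite JE indicE mem_set//= => /eqP; rewrite oner_eq0.
have nJ0 : 0 < `|orlicz_class J| by rewrite normr_gt0.
have nJ : `|orlicz_class J| <= c^-1 by rewrite norm_orlicz_class JE.
(* The norm is an infimum that need not be known to be attained, so [f] is divided by an [e]
   strictly above it to bring the modular below 1. *)
have scaled (f : LorliczFun mu phi) (e : R) : luxemburg_norm mu phi (val f) < e ->
    [/\ 0 < e, measurable_fun [set: T] (fun x => val f x / e),
      (I (fun x => val f x / e)%R <= 1)%E &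
      avg (val f) = e * avg (fun x => val f x / e)].
  move=> fe; have [mf ff] := LorliczFunP f.
  have [e0 Ie] := luxemburg_gt mf ff fe.
  have mfe : measurable_fun [set: T] (fun x => val f x / e).
    exact: measurable_funM.
  split=> //; rewrite -avgZ//; last exact: modular_finite.
  by congr avg; apply/funext => x; rewrite mulrC divfK// gt_eqF.
have A1 x : `|A x| <= 1 * `|x|.
  have [f ->] := orlicz_class_surj x; rewrite [A _]A0E mul1r.
  apply/ler_addgt0Pr => t t0.
  have [|e0 mfe Ie avgE] := scaled f (`|orlicz_class f| + t).
    by rewrite norm_orlicz_class ltrDl.
  rewrite normrZ normrN avgE normrM gtr0_norm// -mulrA ler_piMr ?(ltW e0)//.
  apply: (@le_trans _ _ (c * c^-1)); last by rewrite divff// gt_eqF.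
  by rewrite ler_pM// averaging_contraction.
have [delta delta0 gapH] := averaging_gap.
have BA x : `|x + A x| <= (2 - delta) * `|x|.
  have [f ->] := orlicz_class_surj x; rewrite [A _]A0E.
  apply/ler_addgt0Pr => t t0.
  (* The excess is [t / 2] because the factor [2 - delta] is below 2. *)
  have [|e0 mfe Ie avgE] := scaled f (`|orlicz_class f| + t / 2).
    by rewrite norm_orlicz_class ltrDl divr_gt0.
  set e := _ + _ in e0 mfe Ie avgE.
  have := gapH _ mfe Ie; rewrite -(ler_pM2l e0).
  have mg : measurable_fun [set: T]
      (fun x => val f x / e - avg (fun x => val f x / e) * \1_B x).
    by apply: measurable_funB => //; apply: measurable_funM => //; exact: m1.
  have fg : finite_modular mu phi
      (fun x => val f x / e - avg (fun x => val f x / e) * \1_B x).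
    rewrite (_ : (fun x => _) = (fun x =>
        - avg (fun x => val f x / e) * \1_B x + val f x / e)); last first.
      by apply/funext => y; rewrite mulNr addrC.
    exact: (finite_modular_comb _ (m1 mB) mfe finB (modular_finite Ie)).
  rewrite -[X in X * nm _](gtr0_norm e0) -(luxemburgZ e mg fg).
  rewrite -orlicz_classZ -orlicz_classD norm_orlicz_class.
  rewrite (_ : (fun y => _) = val (f + (- avg (val f)) *: J)); last first.
    apply/funext => y; rewrite mulrBr [e * (_ / _)]mulrC divfK ?gt_eqF// mulrA -avgE.
    by rewrite -JE -mulNr.
  move=> /le_trans; apply; rewrite mulrC /e mulrDr lerD2l.
  rewrite mulrBl [2 * _]mulrC divfK// lerBlDr lerDl.
  by rewrite mulr_ge0// ltW// divr_gt0.
have AZ k x : A (k *: x) = k *: A x by rewrite linearZ.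
have bA : bounded_near A (nbhs (0 : X)).
  apply/linear_boundedP; exists 1; split => // r r1 x.
  by rewrite (le_trans (A1 x))// ler_wpM2r// ltW.
have AJ (k : R) : A (orlicz_class (k *: J)) = - k *: orlicz_class J.
  rewrite [A _]A0E; have -> : val (k *: J) = (fun x => k * \1_B x).
    by rewrite linearZ/= JE.
  by rewrite avgZ ?avg_indic ?mulr1//; exact: m1.
have rA : rank_one A.
  exists (orlicz_class J) => //; apply/seteqP; split => [_ [x _ <-]|_ [k _ <-]].
    by exists (- avg (val (repr x))).
  by exists (orlicz_class (- k *: J)) => //; rewrite AJ opprK.
move=> /(_ A bA rA).
have N1 : 1 <= opnorm A.
  have := opnorm_ub AZ A1 (orlicz_class (1 *: J)).
  by rewrite AJ scale1r normrZ normrN normr1 mul1r -ler_pdivrMr// divff// gt_eqF.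
have d2 : 0 <= 2 - delta.
  by have := BA (orlicz_class J); rewrite -ler_pdivrMr//; apply: le_trans;
    rewrite divr_ge0.
have : opnorm (fun x => x + A x) <= 2 - delta.
  by apply: opnorm_le => x x1; rewrite (le_trans (BA x))// ler_piMr.
move=> + E; rewrite E leNgt => /negP; apply.
by apply: (@lt_le_trans _ _ 2); [rewrite gtrBl|rewrite -[2]/(1 + 1) lerD2l].
Qed.

End conditional_expectation.

(** * From the Daugavet property to linearity, and the equivalences *)

Lemma daugavet_linear d (T : measurableType d) (R : realType)
    (mu : {measure set T -> \bar R}) (phi : orliczFunction R) :
  sigma_finite [set: T] mu -> (0 < mu [set: T])%E -> nonatomic mu ->
  finite_orlicz phi -> daugavet_property (OrliczSpace mu phi) ->
  exists2 k : R, 0 < k & forall u : R, 0 <= u -> phi u = (k * u)%:E.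
Proof.
move=> mu_sf mu_gt0 mu_na phi_fin daug.
pose p (u : R) := fine (phi u).
have pE (u : R) : 0 <= u -> phi u = (p u)%:E by exact: finite_orlicz_fineE.
have p_ge0 (u : R) : 0 <= u -> 0 <= p u.
  by move=> u0; rewrite fine_ge0// orlicz_ge0.
have p0 : p 0 = 0 by rewrite /p orlicz0.
have p_convex (t u v : R) : 0 <= t <= 1 -> 0 <= u -> 0 <= v ->
    p (t * u + (1 - t) * v) <= t * p u + (1 - t) * p v.
  move=> t01 u0 v0; have := orlicz_convex phi t01 u0 v0.
  have [t0 t1] := andP t01.
  rewrite !pE// ?addr_ge0 ?mulr_ge0 ?subr_ge0//.
have contract := convex_contract p0 p_convex.
(* Either [p u / u] is constant for positive [u], with value [p 1], or by [contract] it increases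
   strictly somewhere. *)
have [lin|] := pselect (forall u v, 0 < u -> u < v -> p u * v = u * p v).
  have p1E u : 0 < u -> p u = p 1 * u.
    move=> u0; have [u1|u1|->] := ltgtP u 1; last by rewrite mulr1.
    - by have := lin _ _ u0 u1; rewrite mulr1 mulrC.
    - by have := lin _ _ ltr01 u1; rewrite mul1r.
  exists (p 1).
    have [u u0 phiu] := orlicz_neq0 phi; rewrite lt_def p_ge0// andbT.
    by apply: contra phiu => /eqP p10; rewrite pE ?ltW// p1E// p10 mul0r.
  move=> u; rewrite le_eqVlt => /orP[/eqP <-|u0]; first by rewrite orlicz0 mulr0.
  by rewrite pE ?ltW// p1E.
move=> /existsNP[u /existsNP[v /not_implyP[u0 /not_implyP[uv /eqP puv]]]].
have {}puv : p u * v < u * p v by rewrite lt_neqAle puv contract// ltW.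
have v0 : 0 < v by exact: lt_trans uv.
have pv : 0 < p v.
  rewrite -(pmulr_rgt0 _ u0); apply: le_lt_trans puv.
  by rewrite mulr_ge0// ?p_ge0// ltW.
have [A [mA A0 Afin]] := sigma_finite_ex_pos mu_sf mu_gt0.
(* This size of [B] gives [p v < 1 / mu B], so the point [c] with [p c * mu B = 1] lies beyond [v],
   where [convex_superlinear] applies. *)
have e0 : 0 < (p v + 1)^-1 by rewrite invr_gt0 addr_gt0.
have [B [mB BA /andP[B0 Be]]] := nonatomic_small mu_na mA A0 Afin e0.
have BE : mu B = (fine (mu B))%:E.
  by rewrite fineK// ge0_fin_numE// (le_lt_trans _ Afin)// le_measure ?inE.
have b0 : 0 < fine (mu B).
  by rewrite fine_gt0// B0 (le_lt_trans _ Afin)// le_measure ?inE.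
have vb : p v < (fine (mu B))^-1.
  rewrite BE lee_fin in Be; rewrite -[ltLHS]invrK ltf_pV2 ?posrE ?invr_gt0//.
  by rewrite (le_lt_trans Be)// ltf_pV2 ?posrE// ?addr_gt0// ltrDl.
have [c vc pc] := convex_value p_ge0 p0 p_convex v0 pv vb.
have c0 : 0 < c by exact: lt_trans vc.
have [s sc] := convex_support_line p_convex c0.
have gap := convex_superlinear p0 p_convex u0 uv puv (ltW vc) sc.
exfalso; move: daug.
by apply: (averaging_not_daugavet phi_fin mB b0 BE c0 _ sc gap);
  rewrite -/(p c) pc mulVf// gt_eqF.
Qed.

Theorem theorem4p12 (R : realType) (d : measure_display) (T : measurableType d)
    (mu : {sigma_finite_measure set T -> \bar R}) (phi : orliczFunction R)
    (mu_complete : measure_is_complete mu) (mu_gt0 : (0 < mu [set: T])%E)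
    (mu_nonatomic : nonatomic mu) (phi_finite : finite_orlicz phi) :
  (daugavet_property (OrliczSpace mu phi) <->
     exists2 k : R, 0 < k & forall u : R, 0 <= u -> phi u = (k * u)%:E) /\
  ((exists2 k : R, 0 < k & forall u : R, 0 <= u -> phi u = (k * u)%:E) <->
     exists2 k : R, 0 < k & orlicz_isometric_L1 mu phi k).
Proof.
have DL := daugavet_linear (sigma_finiteT mu) mu_gt0 mu_nonatomic phi_finite.
have LI (k : R) : 0 < k -> (forall u : R, 0 <= u -> phi u = (k * u)%:E) ->
    orlicz_isometric_L1 mu phi k by exact: linear_isometric_L1.
have ID (k : R) : 0 < k -> orlicz_isometric_L1 mu phi k ->
    daugavet_property (OrliczSpace mu phi).
  by move=> k0 iso; exact: isometric_daugavet iso mu_nonatomic.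
split; split.
- exact: DL.
- by move=> [k k0 phiE]; apply: (ID k k0); exact: LI.
- by move=> [k k0 phiE]; exists k => //; exact: LI.
(* Linearity is recovered from the isometry through the Daugavet property. *)
- by move=> [k k0 iso]; apply: DL; exact: ID iso.
Qed.
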